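(* Let $\alpha>0$ and let $\lambda\ne0$ be a finite measure on $\mathcal{P}^*_+$ with $c(\lambda):=\int_{\mathcal{P}^*_+}\sum_{k\ge1}x_k^{-\alpha}\lambda(d\mathbf{x})<\infty$, normalized so that $c(\lambda)\Gamma(\alpha)=1$. Let $(\mathbf{S}_t)_{t\ge0}$ be the branching-stable process with scaling exponent $-\alpha$ constructed from $\lambda$. (i) For every $x>0$ and $t>0$, $$\mathbb{E}(\mathbf{S}_t([0,x]))=\phi(\alpha,1,tx^\alpha),$$ where $\phi(\rho,\beta,z):=\sum_{k=0}^\infty\frac{z^k}{k!\,\Gamma(\rho k+\beta)}$ is the Wright (generalized Bessel) function. (ii) For every $\theta>0$ and $t>0$, $$\mathbb{E}\left(\int_{[0,\infty)}e^{-\theta x}\,\mathbf{S}_t(dx)\right)=\exp(t\theta^{-\alpha}).$$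
   Context: $\mathcal{P}^*_+$ is the space of non-decreasing sequences $\mathbf{x}=(x_k)_{k\ge1}$ in $(0,\infty]$ with $x_1<\infty$ and $\lim_{k\to\infty}x_k=\infty$, with the topology of pointwise convergence; entries equal to $\infty$ are not counted as atoms, and $\infty^{-\alpha}=0$. For $c>0$, $c\mathbf{x}=(cx_k)_{k\ge1}$. Construction of $(\mathbf{S}_t)_{t\ge0}$ from $\lambda$ and $\alpha$. Define the measure $\Lambda^*$ on $\mathcal{P}^*_+$ by $\int F(\mathbf{x})\,\Lambda^*(d\mathbf{x})=\int_0^\infty y^{\alpha-1}\int_{\mathcal{P}^*_+}F(y\mathbf{x})\,\lambda(d\mathbf{x})\,dy$ for measurable $F\ge0$. Let $\mathbf{N}$ be a Poisson point process on $(0,\infty)\times\mathcal{P}^*_+$ with intensity $dt\times\Lambda^*(d\mathbf{x})$, and let $\mathbf{Z}_1$ be the point process on $(0,\infty)^2$ obtained by replacing each atom $(t,\mathbf{x})$ of $\mathbf{N}$ by the atoms $(t,x_k)$, $k\ge1$, $x_k<\infty$. Let $(\mathbf{Z}_n)_{n\ge0}$ be the branching random walk on $\mathbb{R}_+^2$ with reproduction law $\mathbf{Z}_1$: $\mathbf{Z}_0=\delta_{(0,0)}$, and $\mathbf{Z}_{n+1}$ is obtained from $\mathbf{Z}_n$ by replacing each atom $z$ by the translate by $z$ of an independent copy of $\mathbf{Z}_1$. Then $\mathbf{S}_t(B)=\sum_{n\ge0}\mathbf{Z}_n([0,t]\times B)$ for Borel $B\subseteq\mathbb{R}_+$. *)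

(* Defs.v *)
From HB Require Import structures.
From mathcomp Require Import all_boot all_order all_algebra finmap.
From mathcomp Require Import all_classical all_reals all_analysis.
From mathcomp Require Import measurable_realfun lebesgue_stieltjes_measure.

Set Implicit Arguments.
Unset Strict Implicit.
Unset Printing Implicit Defensive.

Import Order.TTheory GRing.Theory Num.Theory.
Import numFieldNormedType.Exports.

Local Open Scope classical_set_scope.
Local Open Scope ring_scope.

Section sequence_space.
Context {R : realType}.

Definition pseq_set : set {ptws nat -> \bar R} :=
  [set x | [/\ forall k, (0 < x k)%E,
               forall k l, (k <= l)%N -> (x k <= x l)%E,
               (x 0%N < +oo)%E &
               x k @[k --> \oo] --> +oo%E]].

Lemma pseq_set_succ :
  pseq_set ((fun k => k.+1%:R%:E) : {ptws nat -> \bar R}).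
Proof.
split=> [k|k l kl||].
- by rewrite lte_fin.
- by rewrite lee_fin ler_nat.
- by rewrite ltry.
- apply/cvgeryP.
  have : (n%:R : R) @[n --> \oo] --> +oo by exact: cvgr_idn.
  by rewrite -(cvg_shiftS (fun n => n%:R : R)).
Qed.

End sequence_space.

(* The space P*_+; its indices are shifted, so that the first entry of x is
   [x 0]. [set_type] carries the subspace topology, which is thus that of
   pointwise convergence. *)
Definition pseq (R : realType) : Type := set_type (@pseq_set R).

Definition seq_of (R : realType) (x : pseq R) : nat -> \bar R := set_val x.
Coercion seq_of : pseq >-> Funclass.

HB.instance Definition _ (R : realType) :=
  Topological.copy (pseq R) (set_type (@pseq_set R)).
HB.instance Definition _ (R : realType) := isPointed.Build (pseq R)
  (exist (fun x => x \in pseq_set) _ (mem_set (@pseq_set_succ R))).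

(* The Borel sigma-algebra. *)
HB.instance Definition _ (R : realType) :=
  Measurable.copy (pseq R) (g_sigma_algebraType (@open (pseq R))).

Section scaling.
Context {R : realType}.
Implicit Types x : pseq R.

Lemma pseqP x : pseq_set (x : nat -> \bar R).
Proof. exact: (set_mem (valP x)). Qed.

Lemma pseq_set_scale (y : R) x : 0 < y ->
  pseq_set ((fun k => y%:E * x k)%E : {ptws nat -> \bar R}).
Proof.
move=> y0; have [x0 xn x1 xoo] := pseqP x; split=> [k|k l kl||].
- by rewrite mule_gt0.
- by rewrite lee_pmul2l// xn.
- have := x0 0%N; move: x1; case: (x 0%N) => // r _ _.
  by rewrite -EFinM ltry.
- have /(cvgeZl (y := y%:E)) := xoo; rewrite gt0_muley ?lte_fin//; exact.
Qed.

(* [y x] for [y > 0]; the value at [y <= 0] is irrelevant. *)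
Definition pscale (y : R) x : pseq R :=
  match pselect (0 < y) with
  | left y0 => exist (fun z => z \in pseq_set) _ (mem_set (pseq_set_scale x y0))
  | right _ => x
  end.

Lemma pscaleE (y : R) x k : 0 < y -> pscale y x k = (y%:E * x k)%E.
Proof. by rewrite /pscale; case: pselect. Qed.

End scaling.

Section pseq_measurable.
Context {R : realType}.

Definition between (p : option rat * option rat) : set (\bar R) :=
  [set y | (if p.1 is Some l then (ratr l)%:E < y else True)%E /\
           (if p.2 is Some u then y < (ratr u)%:E else True)%E].

Lemma nbhs_between (y : \bar R) (O : set (\bar R)) : nbhs y O ->
  exists2 p, between p y & between p `<=` O.
Proof.
case: y => [r| |].
- rewrite {1}/nbhs /= => /nbhs_ballP[e /= e0 reO].
  have /rat_in_itvoo[l] : r - e < r by rewrite ltrBlDr ltrDl.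
  have /rat_in_itvoo[u] : r < r + e by rewrite ltrDl.
  rewrite !in_itv /= => /andP[ru ure] /andP[rel lr].
  exists (Some l, Some u); rewrite /between/= ?lte_fin//.
  move=> [s| |]/=; rewrite ?ltNge ?leey ?leNye//= -?ltNge ?lte_fin; last 2 first.
    by move=> [].
    by move=> [].
  move=> [ls su]; apply: reO; rewrite /ball/= ltr_distlC.
  by rewrite (lt_trans rel ls) (lt_trans su ure).
- rewrite {1}/nbhs /= => -[M [_ MO]].
  have /rat_in_itvoo[l] : M < M + 1 by rewrite ltrDl.
  rewrite in_itv /= => /andP[Ml _].
  exists (Some l, None); rewrite /between/= ?ltry//.
  by move=> y [ly _]; apply: MO; rewrite (lt_trans _ ly)// lte_fin.
- rewrite {1}/nbhs /= => -[M [_ MO]].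
  have /rat_in_itvoo[l] : M - 1 < M by rewrite ltrBlDr ltrDl.
  rewrite in_itv /= => /andP[_ Ml].
  exists (None, Some l); rewrite /between/= ?ltNyr//.
  by move=> y [_ ly]; apply: MO; rewrite (lt_trans ly)// lte_fin.
Qed.

Definition box (s : seq (nat * (option rat * option rat))) :
    set {ptws nat -> \bar R} :=
  [set x | forall c, c \in s -> between c.2 (x c.1)].

Lemma nbhs_box (x : {ptws nat -> \bar R}) (A : set {ptws nat -> \bar R}) :
  nbhs x A -> exists2 s, box s x & box s `<=` A.
Proof.
pose F : set_system {ptws nat -> \bar R} :=
  [set A | exists2 s, box s x & box s `<=` A].
suff : F --> x by apply.
have FF : Filter F.
  split.
  - by exists [::].
  - move=> P Q [s sx sP] [t tx tQ]; exists (s ++ t).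
      by move=> c; rewrite mem_cat => /orP[/sx|/tx].
    by move=> z zst; split; [apply: sP|apply: tQ] => c cs; apply: zst;
      rewrite mem_cat cs ?orbT.
  - by move=> P Q PQ [s sx sP]; exists s => //; exact: subset_trans PQ.
apply/(@pointwise_cvgP _ _ F x) => k O /nbhs_between[p px pO].
exists [:: (k, p)] => [c|z zp]; first by rewrite inE => /eqP ->.
by apply: pO; apply: (zp (k, p)); rewrite inE.
Qed.

Lemma measurable_between p : measurable (between p).
Proof.
rewrite (_ : between p = (if p.1 is Some l then `](ratr l)%:E, +oo[ else setT)
    `&` (if p.2 is Some u then `]-oo, (ratr u)%:E[ else setT)); last first.
  by apply/seteqP; split => y; rewrite /between/=;
    case: p.1 => [l|]; case: p.2 => [u|] /=; rewrite ?in_itv/= ?andbT.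
by apply: measurableI; [case: p.1|case: p.2] => // a; exact: emeasurable_itv.
Qed.

(* A map into [pseq R] is measurable as soon as its coordinates are. *)
Lemma measurable_fun_pseq d (T : measurableType d) (f : T -> pseq R) :
  (forall k, measurable_fun [set: T] (fun t => f t k)) ->
  measurable_fun [set: T] f.
Proof.
move=> mf; apply: (@measurability _ _ _ _ _ _ (@open (pseq R))) => //.
move=> _ [_ [V oV <-] <-]; rewrite setTI.
rewrite (_ : _ @^-1` _ = \bigcup_(s in [set s | box s `<=` V])
    (fun t => (f t : nat -> \bar R) : {ptws nat -> \bar R}) @^-1` box s).
  rewrite bigcup_mkcond; apply: countable_bigcupT_measurable => // s.
  case: ifPn => // _.
  elim: s => [|c s ih].
    by rewrite (_ : _ @^-1` _ = setT)//; apply/seteqP; split.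
  rewrite (_ : _ @^-1` _ = ((fun t => f t c.1) @^-1` between c.2) `&`
    ((fun t => (f t : nat -> \bar R) : {ptws nat -> \bar R}) @^-1` box s)).
    apply: measurableI => //; rewrite -[X in measurable X]setTI.
    by apply: mf => //; exact: measurable_between.
  apply/seteqP; split => [t /= ft|t [/= t1 t2] a].
    by split => [|a sa]; apply: ft; rewrite inE ?eqxx ?sa ?orbT.
  by rewrite inE => /orP[/eqP ->//|]; exact: t2.
apply/seteqP; split=> [t /= Vt|t [s /= sV]]; last by move/sV.
have /nbhs_box[s st sV] : nbhs (set_val (f t) : {ptws nat -> \bar R}) V.
  exact: open_nbhs_nbhs.
by exists s.
Qed.

Lemma measurable_coord k : measurable_fun [set: pseq R] (fun x : pseq R => x k).
Proof.
apply: (measurability _ (ErealGenOInfty.measurableE R)) => //.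
move=> _ [_ [r ->] <-]; rewrite setTI.
apply: sub_sigma_algebra.
rewrite preimage_itvoy.
have cval : continuous (set_val : pseq R -> {ptws nat -> \bar R}).
  exact: initial_continuous.
have cproj : continuous (fun z : {ptws nat -> \bar R} => z k).
  exact: (@proj_continuous nat (fun=> \bar R) k).
have oV := (continuousP _).1 cproj _ (@open_ereal_gt_ereal R r%:E).
exact: ((continuousP _).1 cval _ oV).
Qed.

End pseq_measurable.

Section Lambda_star.
Context {R : realType}.
Local Open Scope ereal_scope.

Local Notation mu := (@lebesgue_measure R).

Lemma measurable_pscale :
  measurable_fun [set: R * pseq R] (fun z => pscale z.1 z.2).
Proof.
apply: measurable_fun_pseq => k.
rewrite (_ : (fun z => _) =
    (fun z : R * pseq R => if (0 < z.1)%R then z.1%:E * z.2 k else z.2 k)).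
  have m2 : measurable_fun [set: R * pseq R] (fun z : R * pseq R => z.2 k).
    exact: (measurableT_comp (measurable_coord k)).
  apply: measurable_fun_ifT => //.
    exact: measurable_fun_ltr.
  by apply: emeasurable_funM => //; exact/measurable_EFinP.
apply/funext => -[y x] /=; case: ifPn => [y0|]; first by rewrite pscaleE.
by move=> /negP y0; rewrite /pscale; case: pselect.
Qed.

Lemma measurable_pscaler (y : R) : measurable_fun [set: pseq R] (pscale y).
Proof. exact: (measurableT_comp measurable_pscale (pair1_measurable y)). Qed.

Variables (alpha : R) (lam : {finite_measure set (pseq R) -> \bar R}).

(* Lambda^*, defined by the case F = 1_A of its defining identity; see
   [integral_Lambda_star] for the general case. *)
Definition Lambda_star (A : set (pseq R)) : \bar R :=
  \int[mu]_(y in `]0%R, +oo[) ((y `^ (alpha - 1))%:E * lam (pscale y @^-1` A)).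

Lemma measurable_Lambda_density (A : set (pseq R)) : measurable A ->
  measurable_fun [set: R]
    (fun y => (y `^ (alpha - 1))%:E * lam (pscale y @^-1` A)).
Proof.
move=> mA; apply: emeasurable_funM.
  by apply/measurable_EFinP; exact: measurable_powR.
pose B := (fun z : R * pseq R => pscale z.1 z.2) @^-1` A.
have mB : measurable B by rewrite -[B]setTI; exact: measurable_pscale.
rewrite (_ : (fun y => _) = lam \o xsection B); first exact: measurable_fun_xsection.
by apply/funext => y; rewrite /= xsectionE.
Qed.

Let Lambda_star0 : Lambda_star set0 = 0.
Proof.
by apply: integral0_eq => y _; rewrite preimage_set0 measure0 mule0.
Qed.

Let Lambda_star_ge0 A : 0 <= Lambda_star A.
Proof.
by apply: integral_ge0 => y _; rewrite mule_ge0// lee_fin powR_ge0.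
Qed.

Let Lambda_star_sigma_additive : semi_sigma_additive Lambda_star.
Proof.
move=> F mF tF mUF.
have mpF y n : measurable (pscale y @^-1` F n).
  by rewrite -[X in measurable X]setTI; exact: measurable_pscaler.
rewrite (_ : Lambda_star (\bigcup_n F n) = \sum_(0 <= n <oo) Lambda_star (F n)).
  by apply: is_cvg_ereal_nneg_natsum => n _; exact: Lambda_star_ge0.
rewrite -integral_nneseries//.
- apply: eq_integral => y _; rewrite nneseriesZl//.
  congr (_ * _); rewrite preimage_bigcup measure_semi_bigcup//.
    apply/trivIsetP => i j _ _ ij; rewrite -preimage_setI.
    by move/trivIsetP : tF => /(_ _ _ _ _ ij) ->//; rewrite preimage_set0.
  exact: bigcupT_measurable.
- by move=> n; apply: measurable_funTS; exact: measurable_Lambda_density.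
- by move=> n y _; rewrite mule_ge0// lee_fin powR_ge0.
Qed.

HB.instance Definition _ := isMeasure.Build _ _ _ Lambda_star
  Lambda_star0 Lambda_star_ge0 Lambda_star_sigma_additive.

Import HBNNSimple.

Let integral_pscale_nnsfun (f : {nnsfun (pseq R) >-> R}) y :
  \int[lam]_x (f (pscale y x))%:E =
  \sum_(r \in range f) (r%:E * lam (pscale y @^-1` (f @^-1` [set r]))).
Proof.
rewrite -(@ge0_integral_pushforward _ _ _ _ _ _ (measurable_pscaler y)
  lam setT (EFin \o f))//.
- rewrite integralT_nnsfun; first exact: measurable_pscaler.
  by move=> mp; rewrite sintegralE.
- exact/measurable_EFinP.
- by move=> x _; rewrite lee_fin.
Qed.

Lemma integral_Lambda_star (F : pseq R -> \bar R) :
  (forall x, 0 <= F x) -> measurable_fun [set: pseq R] F ->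
  \int[Lambda_star]_x F x =
  \int[mu]_(y in `]0%R, +oo[)
    ((y `^ (alpha - 1))%:E * \int[lam]_x F (pscale y x)).
Proof.
move=> F0 mF; pose f := nnsfun_approx measurableT mF.
pose G n y := (y `^ (alpha - 1))%:E * \int[lam]_x (f n (pscale y x))%:E.
have fF x : (f n x)%:E @[n --> \oo] --> F x by exact: cvg_nnsfun_approx.
have ndf a b x : (a <= b)%N -> (f a x)%:E <= (f b x)%:E.
  by move=> ab; rewrite lee_fin; exact/lefP/nd_nnsfun_approx.
have mf n y : measurable_fun setT (fun x => (f n (pscale y x))%:E).
  by apply/measurable_EFinP; apply: measurableT_comp => //; exact: measurable_pscaler.
have GE n : G n = fun y => \sum_(r \in range (f n))
    (r%:E * ((y `^ (alpha - 1))%:E * lam (pscale y @^-1` (f n @^-1` [set r])))).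
  apply/funext => y; rewrite /G integral_pscale_nnsfun ge0_mule_fsumr.
    by apply: eq_fsbigr => r _; rewrite muleCA.
  move=> r; apply: (mulemu_ge0 (fun r => pscale y @^-1` (f n @^-1` [set r]))).
  by move=> r0; rewrite preimage_nnfun0// preimage_set0.
have mr n r : measurable_fun (`]0%R, +oo[ : set R) (fun y : R =>
    (y `^ (alpha - 1))%:E * lam (pscale y @^-1` (f n @^-1` [set r]))).
  by apply: measurable_funTS; exact: measurable_Lambda_density.
have r0 n r y : 0 <= r%:E *
    ((y `^ (alpha - 1))%:E * lam (pscale y @^-1` (f n @^-1` [set r]))).
  have [r0|r0] := leP 0%R r.
    by rewrite !mule_ge0// lee_fin powR_ge0.
  by rewrite preimage_nnfun0// preimage_set0 measure0 !mule0.
have mG n : measurable_fun (`]0%R, +oo[ : set R) (G n).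
  rewrite GE; apply: emeasurable_fsum => // r.
  exact: measurable_funeM.
have intf n : \int[Lambda_star]_x (f n x)%:E = \int[mu]_(y in `]0%R, +oo[) G n y.
  rewrite integralT_nnsfun sintegralE GE ge0_integral_fsum//.
    apply: eq_fsbigr => r _.
    have [r0'|r0'] := leP 0%R r.
      rewrite ge0_integralZl//.
        exact: mr.
      by move=> y _; rewrite mule_ge0// lee_fin powR_ge0.
    rewrite preimage_nnfun0// measure0 mule0 integral0_eq// => y _.
    by rewrite preimage_set0 measure0 !mule0.
  by move=> r; apply: measurable_funeM; exact: mr.
transitivity (\int[Lambda_star]_x lim ((f n x)%:E @[n --> \oo])).
  by apply: eq_integral => x _; apply/esym/cvg_lim.
rewrite monotone_convergence//; last 3 first.
- by move=> n; exact/measurable_EFinP.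
- by move=> n x _; rewrite lee_fin.
- by move=> x _ a b; exact: ndf.
under eq_fun do rewrite intf.
have Gnd y a b : (a <= b)%N -> G a y <= G b y.
  move=> ab; rewrite lee_wpmul2l// ?lee_fin ?powR_ge0//.
  by apply: ge0_le_integral => // x _; [rewrite lee_fin|exact: ndf].
rewrite -monotone_convergence//; last 2 first.
- move=> n y _; rewrite mule_ge0// ?lee_fin ?powR_ge0//.
  by apply: integral_ge0 => x _; rewrite lee_fin.
- by move=> y _ a b; exact: Gnd.
apply: eq_integral => y _.
rewrite /G limeMl//; last first.
  apply: ereal_nondecreasing_is_cvgn => a b ab.
  by apply: ge0_le_integral => // x _; [rewrite lee_fin|exact: ndf].
rewrite -monotone_convergence//; last 2 first.
- by move=> n x _; rewrite lee_fin.
- by move=> x _ a b; exact: ndf.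
by congr (_ * _); apply: eq_integral => x _; exact/cvg_lim.
Qed.

End Lambda_star.

Section point_measures.
Context d (T : measurableType d) (R : realType) (I : choiceType).
Local Open Scope ereal_scope.
Variable xi : I -> option T.

(* The sum of the Dirac masses at the defined [xi i]: the number of i such that
   [xi i] is a point of [A]. *)
Definition point_measure (A : set T) : \bar R := \esum_(i in xi @^-1` (Some @` A)) 1.

Let point_measure0 : point_measure set0 = 0.
Proof.
by rewrite /point_measure image_set0 preimage_set0 esum_set0.
Qed.

Let point_measure_ge0 A : 0 <= point_measure A.
Proof. exact: esum_ge0. Qed.

Let point_measure_sigma_additive : semi_sigma_additive point_measure.
Proof.
move=> F mF tF mUF.
rewrite (_ : point_measure (\bigcup_n F n) = \sum_(0 <= n <oo) point_measure (F n)).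
  by apply: is_cvg_ereal_nneg_natsum => n _; exact: esum_ge0.
rewrite /point_measure -nneseries_sum_bigcup//.
  by rewrite image_bigcup preimage_bigcup.
apply/trivIsetP => m n _ _ mn; apply/seteqP; split => // i [[z Fz xiz] [w Fw]].
rewrite -xiz => -[zw]; subst w.
have /trivIsetP/(_ m n Logic.I Logic.I mn) FmnE := tF.
by have : (F m `&` F n) z by []; rewrite FmnE.
Qed.

HB.instance Definition _ := isMeasure.Build _ _ _ point_measure
  point_measure0 point_measure_ge0 point_measure_sigma_additive.

End point_measures.
Arguments point_measure {d T R I} xi A.

(* Mutual independence of a family of classes of events. *)
Definition mutually_independent d (Omega : measurableType d) (R : realType)
    (P : probability Omega R) (I : choiceType)
    (F : I -> set_system Omega) : Prop :=
  forall (J : {fset I}) (E : I -> set Omega),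
    (forall i, i \in J -> F i (E i)) ->
    P (\bigcap_(i in [set` J]) E i) = (\prod_(i <- J) P (E i))%E.

Section poisson_point_process.
Context d (Omega : measurableType d) (R : realType) (P : probability Omega R).
Context d' (T : measurableType d').

(* The sigma-algebra generated by the random atoms [xi i]. *)
Definition enum_events (xi : nat -> Omega -> option T) : set_system Omega :=
  <<s [set E | exists i, exists2 A, measurable A &
                 E = xi i @^-1` (Some @` A)] >>.

(* [xi] is an enumeration, by possibly undefined random points, of the atoms of
   a Poisson point process with intensity [mu]. *)
Definition poisson_point_process (mu : set T -> \bar R)
    (xi : nat -> Omega -> option T) : Prop :=
  let N (A : set T) (w : Omega) : \bar R := point_measure (xi^~ w) A in
  [/\ forall i A, measurable A -> measurable (xi i @^-1` (Some @` A)),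
      forall A m, measurable A -> mu A = m%:E ->
        forall n, P [set w | N A w = n%:R%:E] =
                  (m ^+ n / n`!%:R * expR (- m))%:E,
      forall A, measurable A -> mu A = +oo%E ->
        P [set w | N A w = +oo%E] = 1%E &
      forall n (A : 'I_n -> set T), (forall i, measurable (A i)) ->
        trivIset [set: 'I_n] A ->
        mutually_independent P
          (fun i => preimage_set_system [set: Omega] (N (A i)) measurable)].

End poisson_point_process.

Section branching_stable.
Context {R : realType}.

(* dt on (0,oo) times Lambda^*, as a measure on R * P*_+. [Lambda_star] is only
   sigma-finite under conditions on [lam], whence [\x^], whose construction only
   needs sigma-finiteness of the first factor. *)
Definition ppp_intensity (alpha : R)
    (lam : {finite_measure set (pseq R) -> \bar R}) :
    set (R * pseq R) -> \bar R :=
  (mrestr (@lebesgue_measure R) (measurable_itv `]0%R, +oo[) \x^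
   Lambda_star alpha lam)%E.

(* The atoms of Z_1, when [zeta] enumerates those of N: label (i, k) is the
   atom (t, x k) if the i-th atom of N is (t, x) and x k is finite. *)
Definition offspring (zeta : nat -> option (R * pseq R)) (c : nat * nat) :
    option (R * R) :=
  if zeta c.1 is Some (t, x) then
    if x c.2 is r%:E then Some (t, r) else None
  else None.

(* Individuals of the branching random walk are labelled by words with one
   letter (i, k) per generation, most recent first: [c :: v] is the child of [v]
   with label [c] in its litter. [zeta v] enumerates the copy of N used by [v].
   The position is undefined when there is no such individual. *)
Fixpoint position (zeta : seq (nat * nat) -> nat -> option (R * pseq R))
    (u : seq (nat * nat)) : option (R * R) :=
  if u is c :: v then
    match position zeta v, offspring (zeta v) c with
    | Some (t, x), Some (s, y) => Some (t + s, x + y)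
    | _, _ => None
    end
  else Some (0, 0).

(* The copies of N attached to the individuals are i.i.d.; independence is that
   of the enumerations, which rules out labels carrying information on the
   other copies. *)
Definition branching_family d (Omega : measurableType d)
    (P : probability Omega R) (alpha : R)
    (lam : {finite_measure set (pseq R) -> \bar R})
    (xi : seq (nat * nat) -> nat -> Omega -> option (R * pseq R)) : Prop :=
  (forall u, poisson_point_process P (ppp_intensity alpha lam) (xi u)) /\
  mutually_independent P (fun u => enum_events (xi u)).

Variable zeta : seq (nat * nat) -> nat -> option (R * pseq R).

(* Z_n *)
Definition brw (n : nat) : set (R * R) -> \bar R :=
  point_measure (fun u : n.-tuple (nat * nat) => position zeta u).

(* S_t *)
Definition bsp (t : R) (B : set R) : \bar R :=
  (\sum_(0 <= n <oo) brw n (`[0%R, t] `*` B))%E.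

Local Open Scope ereal_scope.

Let bsp0 t : bsp t set0 = 0.
Proof.
by rewrite /bsp eseries0// => n _ _; rewrite setX0 /brw measure0.
Qed.

Let bsp_ge0 t B : 0 <= bsp t B.
Proof. by apply: nneseries_ge0 => n _ _; exact: measure_ge0. Qed.

Let bsp_sigma_additive t : semi_sigma_additive (bsp t).
Proof.
move=> F mF tF mUF.
rewrite (_ : bsp t (\bigcup_n F n) = \sum_(0 <= n <oo) bsp t (F n)).
  by apply: is_cvg_ereal_nneg_natsum => n _; exact: bsp_ge0.
rewrite /bsp nneseries_interchange//; apply: eq_eseriesr => n _.
rewrite setX_bigcupr /brw measure_semi_bigcup//.
- by move=> k; exact: measurableX.
- apply/trivIsetP => i j _ _ ij; rewrite -setXI setIid.
  have /trivIsetP/(_ i j Logic.I Logic.I ij) -> := tF.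
  by rewrite setX0.
- by apply: bigcupT_measurable => k; exact: measurableX.
Qed.

HB.instance Definition _ t := isMeasure.Build _ _ _ (bsp t)
  (bsp0 t) (bsp_ge0 t) (@bsp_sigma_additive t).

End branching_stable.

Section constants.
Context {R : realType}.

(* Euler's integral, meaningful for 0 < a. *)
Definition Gamma (a : R) : R :=
  \int[@lebesgue_measure R]_(t in `]0, +oo[) (t `^ (a - 1) * expR (- t)).

(* The Wright function; since [Gamma] is Euler's integral this is only
   meaningful for 0 <= rho and 0 < beta. *)
Definition Wright (rho beta z : R) : R :=
  limn (series (fun k => z ^+ k / (k`!%:R * Gamma (rho * k%:R + beta)))).

(* x^(-alpha) on (0,oo], with oo^(-alpha) = 0; [poweR] would give +oo at +oo *)
Definition inv_pow (alpha : R) (x : \bar R) : \bar R :=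
  if x is r%:E then (r `^ (- alpha))%:E else 0%E.

Definition c_lambda (alpha : R) (lam : set (pseq R) -> \bar R) : \bar R :=
  (\int[lam]_x \sum_(0 <= k <oo) inv_pow alpha (seq_of x k))%E.

End constants.

(* Main.v *)
(* By Campbell's formula and the scaling of Lambda^*, the mean measure of Z_1 is
   ds (y^(alpha-1) / Gamma(alpha)) dy on (0,oo)^2. The position of an individual
   being independent of its litter, the mean measure of Z_n is the n-fold
   convolution power of the mean of Z_1. Convolution with ds maps (t-s)_+^n / n!
   to (t-s)_+^(n+1) / (n+1)!, while convolution with y^(alpha-1) / Gamma(alpha)
   maps (x-y)_+^(n alpha) / Gamma(n alpha + 1) to the same expression at n + 1
   (Euler's beta integral) and multiplies e^(-theta y) by theta^(-alpha). Thus
   E Z_n([0,t] x [0,x]) = t^n x^(n alpha) / (n! Gamma(n alpha + 1)) and the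
   Laplace transform of E Z_n([0,t] x .) is t^n theta^(-n alpha) / n!; both
   statements follow by summing over n. *)
Require Import Defs.
From HB Require Import structures.
From mathcomp Require Import all_boot all_order all_algebra finmap.
From mathcomp Require Import all_classical all_reals all_analysis.
From mathcomp Require Import measurable_realfun lebesgue_stieltjes_measure.
From mathcomp Require Import ring.

Set Implicit Arguments.
Unset Strict Implicit.
Unset Printing Implicit Defensive.

Import Order.TTheory GRing.Theory Num.Theory.
Import numFieldNormedType.Exports.

Local Open Scope classical_set_scope.
Local Open Scope ring_scope.

(** * Integrals and countable sums *)

(** Convolution powers are never formed. The mean measure of Z_1 acts on test functions instead: the
    function to be integrated is the start of an explicit sequence of functions of the starting
    point, each mapped to the next by this action, and the n-th one is evaluated at the origin.
    Everything is nonnegative with values in [0,+oo], so monotone convergence and Tonelli do all the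
    exchanges. Two obstacles shape the rest. Individuals may fail to exist, so positions are
    partially defined random points, with laws of mass at most one. And [Gamma] takes the value 0
    where Euler's integral diverges, so finiteness at the points n alpha + 1 has to be proved: the
    normalization gives it at alpha, and the beta identity, valid in [0,+oo], propagates it from
    Gamma(1) = 1 by steps of alpha. *)

Section mixture.
Context d d' (Y : measurableType d) (T : measurableType d') (R : realType).
Local Open Scope ereal_scope.
Variables (nu : {measure set Y -> \bar R}) (D : set Y) (mD : measurable D).
Variables (k : Y -> {measure set T -> \bar R}) (m : {measure set T -> \bar R}).
Hypothesis mk : forall A, measurable A -> measurable_fun setT (k ^~ A).
Hypothesis mE : forall A, measurable A -> m A = \int[nu]_(y in D) k y A.

Import HBNNSimple.

(** Linearity gives the identity for simple functions, monotone convergence for the others.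
    Restrictions, laws, point measures, product measures and S_t are all integrated by writing them
    as mixtures of simpler measures. *)
Lemma integral_mixture (f : T -> \bar R) : (forall x, 0 <= f x) ->
  measurable_fun setT f ->
  \int[m]_x f x = \int[nu]_(y in D) \int[k y]_x f x.
Proof.
move=> f0 mf; pose g := nnsfun_approx measurableT mf.
have gf x : (g n x)%:E @[n --> \oo] --> f x by exact: cvg_nnsfun_approx.
have ndg x : {homo (fun n => (g n x)%:E) : a b / (a <= b)%N >-> a <= b}.
  by move=> a b ab; rewrite lee_fin; exact/lefP/nd_nnsfun_approx.
have fE (m' : {measure set T -> \bar R}) :
    \int[m']_x f x = limn (fun n => \int[m']_x (g n x)%:E).
  rewrite -monotone_convergence//.
  - by apply: eq_integral => x _; apply/esym/cvg_lim.
  - by move=> n; exact/measurable_EFinP.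
  - by move=> n x _; rewrite lee_fin.
rewrite fE; under [RHS]eq_integral do rewrite fE.
rewrite monotone_convergence//; last 3 first.
- move=> n; apply: measurable_funTS.
  apply: measurable_fun_integral_kernel => //.
    by move=> x; rewrite lee_fin.
  exact/measurable_EFinP.
- by move=> n y _; apply: integral_ge0 => x _; rewrite lee_fin.
- move=> y _ a b ab; apply: ge0_le_integral => //.
  + by move=> x _; rewrite lee_fin.
  + exact/measurable_EFinP.
  + exact/measurable_EFinP.
  + by move=> x _; exact: ndg.
apply/congr_lim/funext => n.
under [RHS]eq_integral do rewrite integralT_nnsfun sintegralE.
rewrite integralT_nnsfun sintegralE ge0_integral_fsum//; last 2 first.
- by move=> r; apply: measurable_funTS; apply: measurable_funeM; exact: mk.
- move=> r y _; have [r0|r0] := leP 0%R r; first by rewrite mule_ge0.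
  by rewrite preimage_nnfun0// measure0 mule0.
apply: eq_fsbigr => r _; rewrite mE//.
have [r0|r0] := leP 0%R r.
  by rewrite ge0_integralZl//; apply: measurable_funTS; exact: mk.
rewrite preimage_nnfun0// (eq_integral (cst 0)) ?integral0 ?mule0//.
  by rewrite integral0_eq// => y _; rewrite measure0 mule0.
by move=> y _; rewrite measure0.
Qed.

End mixture.

(** The restriction to [D] is the mixture over [D] of the Dirac masses. *)
Lemma integral_mrestr d (T : measurableType d) (R : realType)
    (mu : {measure set T -> \bar R}) (D : set T) (mD : measurable D)
    (f : T -> \bar R) : (forall x, (0 <= f x)%E) -> measurable_fun setT f ->
  (\int[mrestr mu mD]_x f x = \int[mu]_(x in D) f x)%E.
Proof.
move=> f0 mf.
have -> : (\int[mu]_(x in D) f x = \int[mu]_(x in D) \int[\d_x]_y f y)%E.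
  by apply: eq_integral => x _; rewrite integral_dirac// diracT mul1e.
apply: integral_mixture => // A mA.
  exact: measurable_fun_dirac.
by rewrite integral_indic.
Qed.

Section sum_over_countable.
Context {R : realType} {I : countType}.
Local Open Scope ereal_scope.

(** Lists the family along its integer codes, with 0 at integers that code nothing, so that sums
    over labels become series. *)
Definition nth_term (a : I -> \bar R) n := oapp a 0 (@pickle_inv I n).

Lemma esum_countable (a : I -> \bar R) : (forall i, 0 <= a i) ->
  \esum_(i in setT) a i = \sum_(0 <= n <oo) nth_term a n.
Proof.
move=> a0; rewrite nneseries_esumT; last first.
  by move=> n; rewrite /nth_term; case: pickle_inv.
rewrite [RHS](_ : _ = \esum_(n in range (@choice.pickle I)) nth_term a n).
  rewrite (reindex_esum [set: I] (range (@choice.pickle I)) (@choice.pickle I)).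
    by apply: eq_esum => i _; rewrite /nth_term pickleK_inv.
  split=> [i _|i j _ _ /(pcan_inj choice.pickleK)//|_ [i _ <-]]; by exists i.
rewrite [RHS]esum_mkcond; apply: eq_esum => n _; case: ifPn => // nI.
rewrite /nth_term; case E : pickle_inv => [i|//].
case/negP: nI; apply/mem_set; exists i => //.
by have := @pickle_invK I n; rewrite /ocancel E.
Qed.

Lemma integral_esum d (T : measurableType d) (mu : {measure set T -> \bar R})
    (D : set T) (f : I -> T -> \bar R) : measurable D ->
  (forall i, measurable_fun D (f i)) -> (forall i x, 0 <= f i x) ->
  \int[mu]_(x in D) (\esum_(i in setT) f i x) =
  \esum_(i in setT) \int[mu]_(x in D) f i x.
Proof.
move=> mD mf f0.
under eq_integral do rewrite esum_countable//.
rewrite esum_countable; last by move=> i; exact: integral_ge0.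
rewrite integral_nneseries//.
- apply: eq_eseriesr => n _; rewrite /nth_term; case: pickle_inv => //=.
  by rewrite integral0.
- by move=> n; rewrite /nth_term; case: pickle_inv => //=; exact: measurable_cst.
- by move=> n x _; rewrite /nth_term; case: pickle_inv => /=.
Qed.

Lemma measurable_fun_esum d (T : measurableType d) (D : set T)
    (f : I -> T -> \bar R) :
  (forall i, measurable_fun D (f i)) -> (forall i x, 0 <= f i x) ->
  measurable_fun D (fun x => \esum_(i in setT) f i x).
Proof.
move=> mf f0; rewrite (_ : (fun x => _) =
    (fun x => \sum_(0 <= n <oo) nth_term (f^~ x) n)).
  apply: (@ge0_emeasurable_sum _ _ _ D (fun n x => nth_term (f^~ x) n) xpredT).
    by move=> n x _ _; rewrite /nth_term; case: pickle_inv => /=.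
  by move=> n _; rewrite /nth_term; case: pickle_inv => //=; exact: measurable_cst.
by apply/funext => x; rewrite esum_countable.
Qed.

(** As [c] may be infinite, the series is read as an integral against the counting measure. *)
Lemma esum_countableZl (c : \bar R) (a : I -> \bar R) : (forall i, 0 <= a i) ->
  0 <= c -> \esum_(i in setT) (c * a i) = c * \esum_(i in setT) a i.
Proof.
move=> a0 c0; rewrite !esum_countable//; last by move=> i; exact: mule_ge0.
have nt0 n : 0 <= nth_term a n by rewrite /nth_term; case: pickle_inv.
rewrite -[in RHS]ge0_integral_count// -ge0_integralZl// ge0_integral_count//.
  apply: eq_eseriesr => n _; rewrite /nth_term.
  by case: pickle_inv => //=; rewrite mule0.
by move=> n; exact: mule_ge0.
Qed.

End sum_over_countable.


(** * Partially defined random points *)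

(** Taking [A] to be the whole space shows that the event where [X] is defined is measurable as
    well. *)
Definition measurable_option d (Omega : measurableType d) d' (T : measurableType d')
    (X : Omega -> option T) : Prop :=
  forall A, measurable A -> measurable (X @^-1` (Some @` A)).

Lemma preimage_some T T' (X : T' -> option T) (A : set T) :
  X @^-1` (Some @` A) = [set w | if X w is Some a then A a else False].
Proof.
apply/seteqP; split => w /=; first by move=> [a Aa <-].
by case: (X w) => // a Aa; exists a.
Qed.

Section measurable_option.
Context d (Omega : measurableType d) d' (T : measurableType d').

Lemma measurable_omap d'' (T' : measurableType d'') (g : T -> T')
    (X : Omega -> option T) : measurable_fun setT g -> measurable_option X ->
  measurable_option (fun w => omap g (X w)).
Proof.
move=> mg mX B mB; rewrite (_ : _ @^-1` _ = X @^-1` (Some @` (g @^-1` B))).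
  by apply: mX; rewrite -[_ @^-1` _]setTI; exact: mg.
by rewrite !preimage_some; apply/seteqP; split => w /=; case: (X w).
Qed.

Lemma measurable_obind d'' (T' : measurableType d'') (D : set T) (g : T -> T')
    (h : T -> option T') (X : Omega -> option T) : measurable D ->
  measurable_fun D g -> (forall t, D t -> h t = Some (g t)) ->
  (forall t, ~ D t -> h t = None) -> measurable_option X ->
  measurable_option (fun w => obind h (X w)).
Proof.
move=> mD mg hD hND mX B mB.
rewrite (_ : _ @^-1` _ = X @^-1` (Some @` (D `&` g @^-1` B))).
  by apply: mX; exact: mg.
rewrite !preimage_some; apply/seteqP; split => w /=; case: (X w) => //= t.
  have [/[dup] Dt /hD ->|/hND ->//] := pselect (D t); exact.
by move=> [/hD ->].
Qed.

Definition opair T1 T2 (X : option T1) (Y : option T2) : option (T1 * T2) :=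
  if X is Some a then omap (pair a) Y else None.

(** The sets with measurable preimage form a sigma-algebra containing the rectangles. Complements
    are taken inside the event that both points are defined, which is the preimage of the full
    rectangle. *)
Lemma measurable_opair d'' (T' : measurableType d'') (X : Omega -> option T)
    (Y : Omega -> option T') : measurable_option X -> measurable_option Y ->
  measurable_option (fun w => opair (X w) (Y w)).
Proof.
move=> mX mY C.
pose m C := measurable ((fun w => opair (X w) (Y w)) @^-1` (Some @` C)).
rewrite measurable_prod_measurableType => sC.
have GT : [set A `*` B | A in measurable & B in measurable] [set: T * T'].
  by exists setT => //; exists setT => //; rewrite setXTT.
have mAB (A : set T) (B : set T') : measurable A -> measurable B -> m (A `*` B).
  move=> mA mB; rewrite /m (_ : _ @^-1` _ =
      (X @^-1` (Some @` A)) `&` (Y @^-1` (Some @` B))).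
    by apply: measurableI; [exact: mX|exact: mY].
  rewrite !preimage_some; apply/seteqP; split => w /=;
    by case: (X w) => [a|]; case: (Y w) => [b|] //= [].
suff /(_ C sC) : <<s [set A `*` B | A in measurable & B in measurable] >>
  `<=` m by [].
apply: smallest_sub; last by move=> _ [A mA [B mB <-]]; exact: mAB.
split => [|A mA|F mF].
- rewrite /m image_set0 preimage_set0; exact: measurable0.
- rewrite /m (_ : _ @^-1` _ =
      ((fun w => opair (X w) (Y w)) @^-1` (Some @` [set: T * T'])) `\`
      ((fun w => opair (X w) (Y w)) @^-1` (Some @` A))).
    by apply: measurableD => //; rewrite -setXTT; exact: mAB.
  by rewrite !preimage_some; apply/seteqP; split => w /=; case: opair => //= -[].
- by rewrite /m image_bigcup preimage_bigcup; exact: bigcupT_measurable.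
Qed.

End measurable_option.

Section law.
Context d (Omega : measurableType d) (R : realType) (P : probability Omega R).
Local Open Scope ereal_scope.

Section law_def.
Context d' (T : measurableType d').
Implicit Types X : Omega -> option T.

(** A measure whose mass is the probability that [X] is defined. The proof of measurability is an
    argument so that [law mX] can carry a measure structure. *)
Definition law X (mX : measurable_option X) (A : set T) : \bar R :=
  P (X @^-1` (Some @` A)).

Variables (X : Omega -> option T) (mX : measurable_option X).

Let law0 : law mX set0 = 0.
Proof. by rewrite /law image_set0 preimage_set0 measure0. Qed.

Let law_ge0 A : 0 <= law mX A.
Proof. exact: measure_ge0. Qed.

Let law_sigma_additive : semi_sigma_additive (law mX).
Proof.
move=> F mF tF mUF; rewrite /law image_bigcup preimage_bigcup.
apply: measure_semi_sigma_additive.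
- by move=> n; exact: mX.
- apply/trivIsetP => i j _ _ ij; rewrite !preimage_some -subset0 => w /=.
  case: (X w) => [a|] [] // Fia Fja.
  have /trivIsetP/(_ _ _ Logic.I Logic.I ij) Fij0 := tF.
  by have : (F i `&` F j) a by []; rewrite Fij0.
- by rewrite -preimage_bigcup -image_bigcup; exact: mX.
Qed.

HB.instance Definition _ := isMeasure.Build _ _ _ (law mX)
  law0 law_ge0 law_sigma_additive.

Let law_fin : fin_num_fun (law mX).
Proof. by move=> A mA; exact/fin_num_measure/mX. Qed.

HB.instance Definition _ := Measure_isFinite.Build _ _ _ (law mX) law_fin.

Let dirac_option (z : option T) : {measure set T -> \bar R} :=
  if z is Some a then \d_a else mzero.

Let dirac_optionE w A :
  dirac_option (X w) A = (\1_(X @^-1` (Some @` A)) w)%:E.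
Proof.
rewrite preimage_some indicE; case E : (X w) => [a|] /=.
  by rewrite diracE (_ : (w \in _) = (a \in A))//; apply/idP/idP; rewrite !inE /= E.
by rewrite /mzero memNset//= E.
Qed.

Let integral_dirac_option z (f : T -> \bar R) : measurable_fun setT f ->
  \int[dirac_option z]_x f x = oapp f 0 z.
Proof.
move=> mf; case: z => [a|] /=; last by rewrite integral_measure_zero.
by rewrite integral_dirac// diracT mul1e.
Qed.

Let measurable_dirac_option A : measurable A ->
  measurable_fun setT (fun w => dirac_option (X w) A).
Proof.
move=> mA; rewrite (_ : (fun w => _) =
    EFin \o \1_(X @^-1` (Some @` A))); last first.
  by apply/funext => w /=; rewrite dirac_optionE.
by apply/measurable_EFinP; apply: measurable_indic; exact: mX.
Qed.

Lemma measurable_oapp (f : T -> \bar R) : (forall x, 0 <= f x) ->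
  measurable_fun setT f -> measurable_fun setT (fun w => oapp f 0 (X w)).
Proof.
move=> f0 mf; under eq_fun do rewrite -integral_dirac_option//.
exact: (measurable_fun_integral_kernel measurable_dirac_option).
Qed.

(** The law is the mixture over [Omega] of the Dirac masses at [X w], replaced by the zero measure
    where [X] is undefined. *)
Lemma integral_law (f : T -> \bar R) : (forall x, 0 <= f x) ->
  measurable_fun setT f ->
  \int[law mX]_x f x = \int[P]_w oapp f 0 (X w).
Proof.
move=> f0 mf; rewrite (@integral_mixture _ _ _ _ _ P setT _
    (fun w => dirac_option (X w)) (law mX))//.
- by apply: eq_integral => w _; rewrite integral_dirac_option.
- move=> A mA; under eq_integral do rewrite dirac_optionE.
  by rewrite integral_indic ?setIT//; exact: mX.
Qed.

End law_def.

(** By independence the law of the pair agrees with the product of the laws on rectangles, hence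
    everywhere; Tonelli then applies. *)
Lemma integral_indep d1 d2 (T1 : measurableType d1) (T2 : measurableType d2)
    (X : Omega -> option T1) (Y : Omega -> option T2)
    (mX : measurable_option X) (mY : measurable_option Y)
    (f : T1 * T2 -> \bar R) :
  (forall A B, measurable A -> measurable B ->
    P ((X @^-1` (Some @` A)) `&` (Y @^-1` (Some @` B))) =
    P (X @^-1` (Some @` A)) * P (Y @^-1` (Some @` B))) ->
  (forall z, 0 <= f z) -> measurable_fun setT f ->
  \int[P]_w oapp f 0 (opair (X w) (Y w)) =
  \int[law mX]_a \int[law mY]_b f (a, b).
Proof.
move=> XY f0 mf; have mXY := measurable_opair mX mY.
rewrite -(integral_law mXY)// -fubini_tonelli1//.
apply: eq_measure_integral => C mC _; apply/esym.
apply: product_measure_unique => //= A B mA mB; rewrite -XY//.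
rewrite /law; congr (P _); rewrite !preimage_some; apply/seteqP; split => w /=;
  by case: (X w) => [a|]; case: (Y w) => [b|] //= [].
Qed.

End law.

Lemma integral_point_measure d (T : measurableType d) (R : realType)
    (I : countType) (xi : I -> option T) (f : T -> \bar R) :
  (forall x, 0 <= f x)%E -> measurable_fun setT f ->
  (\int[point_measure xi]_x f x = \esum_(i in setT) oapp f 0 (xi i))%E.
Proof.
move=> f0 mf.
pose k n : {measure set T -> \bar R} :=
  if obind xi (pickle_inv n) is Some a then \d_a else mzero.
rewrite (@integral_mixture _ _ _ _ _ counting setT _ k)//.
- rewrite ge0_integral_count; last by move=> n; exact: integral_ge0.
  rewrite esum_countable; last by move=> i; case: (xi i).
  apply: eq_eseriesr => n _; rewrite /k /nth_term; case: pickle_inv => [i|] /=.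
    case: (xi i) => [a|] /=; last by rewrite integral_measure_zero.
    by rewrite integral_dirac// diracT mul1e.
  by rewrite integral_measure_zero.
- move=> A mA; rewrite ge0_integral_count//= /point_measure esum_mkcond.
  rewrite esum_countable; last by move=> i; case: ifPn.
  apply: eq_eseriesr => n _; rewrite /k /nth_term; case: pickle_inv => [i|] //=.
  rewrite preimage_some; case E : (xi i) => [a|] /=.
    rewrite diracE (_ : (i \in _) = (a \in A)); first by case: (a \in A).
    by apply/idP/idP; rewrite !inE /= E.
  by rewrite memNset//= E.
Qed.

(** * Poisson point processes *)

Lemma eseries_EFin {R : realType} (a : nat -> R) : cvgn (series a) ->
  (\sum_(0 <= n <oo) (a n)%:E = (limn (series a))%:E)%E.
Proof.
move=> ca; rewrite -EFin_lim//; apply/congr_lim/funext => n /=.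
by rewrite -sumEFin.
Qed.

Lemma eseries_exp {R : realType} (x : R) :
  (\sum_(0 <= n <oo) (x ^+ n / n`!%:R)%:E = (expR x)%:E)%E.
Proof. exact: eseries_EFin (is_cvg_series_exp_coeff x). Qed.

Section poisson_mean.
Context d (Omega : measurableType d) (R : realType) (P : probability Omega R).
Context d' (T : measurableType d') (mu : set T -> \bar R).
Variable xi : nat -> Omega -> option T.
Hypothesis ppp : poisson_point_process P mu xi.
Local Open Scope ereal_scope.

Lemma measurable_atom i : measurable_option (xi i).
Proof. move=> A mA; have [mxi _ _ _] := ppp; exact: mxi. Qed.

(** The left side is the mean number of points in [A]. If [mu A] is finite, the Poisson weights sum
    to 1, so this number is almost surely a natural number and its mean is a series. If [mu A] is
    infinite, so is the number, almost surely. *)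
Lemma poisson_mean A : measurable A -> 0 <= mu A ->
  \esum_(i in setT) law P (measurable_atom i) A = mu A.
Proof.
move=> mA muA0; have [_ fin_mu inf_mu _] := ppp.
pose N w : \bar R := point_measure (xi^~ w) A.
have mAi i : measurable (xi i @^-1` (Some @` A)) by exact: measurable_atom.
have NE : N = fun w => \esum_(i in setT) (\1_(xi i @^-1` (Some @` A)) w)%:E.
  apply/funext => w; rewrite /N /point_measure esum_mkcond.
  apply: eq_esum => i _; rewrite indicE.
  rewrite (_ : (i \in _) = (w \in xi i @^-1` (Some @` A))); first by case: ifPn.
  by apply/idP/idP; rewrite !inE.
have mN : measurable_fun setT N.
  rewrite NE; apply: measurable_fun_esum => i.
    by apply/measurable_EFinP; exact: measurable_indic.
  by move=> w; rewrite lee_fin.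
have N0 w : 0 <= N w by exact: esum_ge0.
transitivity (\int[P]_w N w).
  rewrite NE integral_esum//.
  - by apply: eq_esum => i _; rewrite integral_indic ?setIT.
  - by move=> i; apply/measurable_EFinP; exact: measurable_indic.
have mlevel y : measurable [set w | N w = y].
  rewrite (_ : [set w | N w = y] = N @^-1` [set y])//.
  by rewrite -[X in measurable X]setTI; apply: mN => //; exact: emeasurable_set1.
case muAE : (mu A) muA0 => [m| |//] m0; last first.
  have PN1 : P [set w | N w = +oo] = 1 by exact: inf_mu.
  have PN : P (~` [set w | N w = +oo]) = 0.
    by rewrite probability_setC// [X in 1 - X]PN1 subee.
  rewrite (ge0_negligible_integral (N := ~` [set w | N w = +oo]))//; last first.
    exact: measurableC.
  rewrite setTD setCK (eq_integral (cst +oo)).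
    by rewrite integral_cst// [X in _ * X]PN1 mule1.
  by move=> w; rewrite inE.
pose F n := [set w | N w = n%:R%:E].
have mF n : measurable (F n) by exact: mlevel.
have mUF : measurable (\bigcup_n F n) by exact: bigcupT_measurable.
have tF : trivIset setT F.
  apply/trivIsetP => i j _ _ ij; rewrite -subset0 => w [].
  by rewrite /F /= => -> [] /eqP; rewrite eqr_nat (negbTE ij).
have PF n : P (F n) = (m ^+ n / n`!%:R)%:E * (expR (- m))%:E.
  by rewrite -EFinM; exact: fin_mu.
have PUF : P (\bigcup_n F n) = 1.
  rewrite measure_semi_bigcup//.
  transitivity (\sum_(0 <= n <oo) ((expR (- m))%:E * (m ^+ n / n`!%:R)%:E)).
    by apply: eq_eseriesr => n _; rewrite muleC; exact: PF.
  rewrite nneseriesZl; last first.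
    by move=> n _; rewrite lee_fin divr_ge0// exprn_ge0.
  by rewrite eseries_exp -EFinM -expRD addNr expR0.
have PUF0 : P (~` \bigcup_n F n) = 0 by rewrite probability_setC// PUF subee.
rewrite (ge0_negligible_integral (N := ~` \bigcup_n F n))//; last first.
  exact: measurableC.
rewrite setTD setCK ge0_integral_bigcup//; last exact: measurable_funTS.
transitivity (\sum_(0 <= n <oo)
    (n%:R%:E * ((m ^+ n / n`!%:R)%:E * (expR (- m))%:E))).
  apply: eq_eseriesr => n _; rewrite (eq_integral (cst n%:R%:E)).
    by rewrite integral_cst//; congr (_ * _); exact: PF.
  by move=> w; rewrite inE.
(* The term of index 0 vanishes; in the others the factor n cancels against n!, which leaves m times
   the exponential series. *)
rewrite nneseries_recl//; last first.
  by move=> n _; rewrite -PF mule_ge0// lee_fin.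
rewrite mul0e add0e -(@nneseries_addn _ _ 1%N); last first.
  by move=> n; rewrite -PF mule_ge0// lee_fin.
have termS n : (n.+1%:R * (m ^+ n.+1 / n.+1`!%:R * expR (- m)) =
    m * expR (- m) * (m ^+ n / n`!%:R))%R.
  have n0 : (n`!%:R : R) != 0%R by rewrite pnatr_eq0 -lt0n fact_gt0.
  by rewrite factS exprS natrM; field; rewrite n0 nat1r pnatr_eq0.
under eq_eseriesr do rewrite addn1 -!EFinM termS EFinM.
rewrite nneseriesZl; last by move=> n _; rewrite lee_fin divr_ge0// exprn_ge0.
by rewrite eseries_exp -EFinM -mulrA -expRD addNr expR0 mulr1.
Qed.

End poisson_mean.

(** * Independence of positions and litters *)

Section independence.
Context d (Omega : measurableType d) (R : realType) (P : probability Omega R).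
Context (I : choiceType) (F : I -> set_system Omega).
Hypothesis mF : forall i E, F i E -> measurable E.
Hypothesis FT : forall i, F i setT.
Hypothesis FI : forall i, setI_closed (F i).
Hypothesis indepF : mutually_independent P F.
Local Open Scope ereal_scope.

(** A pi-system generating the same sigma-algebra as the union of the [F i] over [J]. The sets [E i]
    outside [K] do not affect the intersection and may be the whole space. *)
Let cylinder (J : set I) : set_system Omega :=
  [set A | exists K : {fset I}, exists E : I -> set Omega,
    [/\ [set` K] `<=` J, forall i, F i (E i) & A = \bigcap_(i in [set` K]) E i]].

Let cylinderI J : setI_closed (cylinder J).
Proof.
move=> _ _ [K [E [KJ FE ->]]] [L [E' [LJ FE' ->]]].
(* Padding with the whole space brings both cylinders to the common index set, the union of [K] and
   [L]. *)
pose EK i := if i \in K then E i else setT.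
pose EL i := if i \in L then E' i else setT.
exists (K `|` L)%fset, (fun i => EK i `&` EL i); split.
- by move=> i /=; rewrite inE => /orP[/KJ|/LJ].
- by move=> i; apply: FI; rewrite /EK /EL; case: ifPn.
- apply/seteqP; split => w.
    move=> [Ew E'w] i _; rewrite /EK /EL; split; case: ifPn => // iKL.
      exact: Ew.
    exact: E'w.
  move=> EEw; split => i /= iKL.
    have [|+ _] := EEw i; first by rewrite /= inE iKL.
    by rewrite /EK iKL.
  have [|_ +] := EEw i; first by rewrite /= inE iKL orbT.
  by rewrite /EL iKL.
Qed.

Let indep_cylinder (J : set I) v E H : ~ J v -> cylinder J E -> F v H ->
  P (E `&` H) = P E * P H.
Proof.
move=> Jv [K [E' [KJ FE' ->]]] FH.
have vK : v \notin K by apply/negP => /KJ.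
(* Since [v] is not in [K], placing [H] at index [v] makes it and the factors of the cylinder
   members of one finite family, to which mutual independence applies. *)
pose E2 i := if i == v then H else E' i.
have E2K i : i \in K -> E2 i = E' i.
  by rewrite /E2; case: eqP => // ->; rewrite (negbTE vK).
have -> : \bigcap_(i in [set` K]) E' i `&` H =
    \bigcap_(i in [set` (v |` K)%fset]) E2 i.
  apply/seteqP; split => w.
    move=> [E'w Hw] i /=; rewrite !inE => /orP[/eqP ->|iK].
      by rewrite /E2 eqxx.
    by rewrite E2K//; exact: E'w.
  move=> E2w; split.
    by move=> i /= iK; rewrite -E2K//; apply: E2w; rewrite /= !inE iK orbT.
  have := E2w v; rewrite /E2 eqxx; apply.
  by rewrite /= !inE eqxx.
rewrite indepF; last first.
  by move=> i _; rewrite /E2; case: eqP => // ->.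
rewrite big_fsetU1//= {1}/E2 eqxx muleC; congr (_ * _).
rewrite indepF//; apply: eq_big_seq => i iK; by rewrite E2K.
Qed.

(** For fixed [H], the events independent of [H] form a Dynkin system, and it contains the cylinders
    over [J]. *)
Lemma indep_sigma_algebra (J : set I) v E H : ~ J v ->
  <<s \bigcup_(i in J) F i >> E -> F v H -> P (E `&` H) = P E * P H.
Proof.
move=> Jv sE FH.
have cm A : cylinder J A -> measurable A.
  move=> [K [E' [_ FE' ->]]]; rewrite bigcap_fset.
  by apply: bigsetI_measurable => i _; exact: mF.
have sm A : <<s cylinder J >> A -> measurable A.
  by apply: smallest_sub A => //; exact: sigma_algebra_measurable.
have mH := mF FH.
suff : <<s cylinder J >> `<=` [set E | P (E `&` H) = P E * P H].
  apply; apply: sub_sigma_algebra2 sE => A [i Ji FA].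
  exists [fset i]%fset, (fun j => if j == i then A else setT); split.
  - by move=> j; rewrite /= inE => /eqP ->.
  - by move=> j; case: eqP => // ->.
  - apply/seteqP; split => w.
      by move=> Aw j; rewrite /= inE => /eqP ->; rewrite eqxx.
    by move/(_ i); rewrite /= inE eqxx; apply.
have UH (A : (set Omega)^nat) : (forall n, measurable (A n)) ->
    trivIset setT A -> (forall n, P (A n `&` H) = P (A n) * P H) ->
    P ((\bigcup_n A n) `&` H) = P (\bigcup_n A n) * P H.
  move=> mA tA PA; rewrite setI_bigcupl measure_semi_bigcup//; last 3 first.
  - by move=> n; exact: measurableI.
  - exact: trivIset_setIr.
  - by apply: bigcupT_measurable => n; exact: measurableI.
  rewrite measure_semi_bigcup//; last exact: bigcupT_measurable.
  have PH : P H \is a fin_num by exact: fin_num_measure.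
  rewrite [RHS]muleC -(fineK PH) -nneseriesZl//.
  by apply: eq_eseriesr => n _; rewrite fineK// muleC; exact: PA.
pose T' := g_sigma_algebraType (cylinder J).
apply: (@dynkin_induction _ T' (cylinder J)) => //.
- by rewrite /= setTI probability_setT mul1e.
- by move=> A cA; exact: indep_cylinder Jv cA FH.
- move=> A /sm mA /= PA.
  rewrite setIC -setDE measureD//; last first.
    by rewrite (le_lt_trans (probability_le1 _ _))// ltry.
  rewrite setIC [X in _ - X]PA probability_setC// muleBl ?mul1e//.
  exact: fin_num_measure.
- by move=> A mA tA PA; apply: UH => // n; exact: sm (A n) (mA n).
Qed.

End independence.

(** Stated for an arbitrary sigma-algebra on [Omega], so that it also applies to the one generated
    by a single copy of N. *)
Lemma measurable_offspring {R : realType} d (Omega : measurableType d)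
    (zeta : nat -> Omega -> option (R * pseq R)) (c : nat * nat) :
  (forall i, measurable_option (zeta i)) ->
  measurable_option (fun w => offspring (zeta^~ w) c).
Proof.
move=> mz; pose xc (z : R * pseq R) : \bar R := z.2 c.2.
have mxc : measurable_fun setT xc.
  exact: (measurableT_comp (measurable_coord c.2)).
have mD : measurable (setT `&` [set z | xc z \is a fin_num]).
  exact: emeasurable_fin_num.
pose h (z : R * pseq R) := if xc z is r%:E then Some (z.1, r) else None.
rewrite (_ : (fun w => _) = fun w => obind h (zeta c.1 w)); last first.
  by apply/funext => w; rewrite /offspring; case: (zeta c.1 w) => [[t x]|].
apply: (measurable_obind mD (g := fun z => (z.1, fine (xc z)))) => //.
- apply: measurable_funTS; apply: measurable_fun_pair => //.
  exact: (measurableT_comp (fine_measurable _)).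
- by move=> z [_ /=]; rewrite /h; case: (xc z).
- by move=> z; rewrite /h /=; case: (xc z) => // r []; split.
Qed.

Lemma position_cons {R : realType}
    (zeta : seq (nat * nat) -> nat -> option (R * pseq R)) c v :
  position zeta (c :: v) =
  omap (fun z => (z.1.1 + z.2.1, z.1.2 + z.2.2))
    (opair (position zeta v) (offspring (zeta v) c)).
Proof.
by rewrite /=; case: position => [[t x]|] //=; case: offspring => [[s y]|].
Qed.

Lemma measurable_translate {R : realType} :
  measurable_fun [set: (R * R) * (R * R)]
    (fun z => (z.1.1 + z.2.1, z.1.2 + z.2.2)).
Proof.
apply: measurable_fun_pair; apply: measurable_funD.
- exact: (measurableT_comp measurable_fst measurable_fst).
- exact: (measurableT_comp measurable_fst measurable_snd).
- exact: (measurableT_comp measurable_snd measurable_fst).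
- exact: (measurableT_comp measurable_snd measurable_snd).
Qed.

(** Only the copies attached to words shorter than [u] are assumed measurable; the position is
    therefore measurable for the sigma-algebra which these copies generate. *)
Lemma measurable_position {R : realType} d (Omega : measurableType d)
    (zeta : seq (nat * nat) -> nat -> Omega -> option (R * pseq R)) u :
  (forall v i, (size v < size u)%N -> measurable_option (zeta v i)) ->
  measurable_option (fun w => position (fun v i => zeta v i w) u).
Proof.
elim: u => [|c v ih] mz.
  move=> A mA; rewrite preimage_some /=.
  have [A00|A00] := pselect (A (0, 0)).
    by rewrite (_ : [set _ | _] = setT)//; apply/seteqP; split.
  by rewrite (_ : [set _ | _] = set0)//; apply/seteqP; split.
under eq_fun do rewrite position_cons.
apply: measurable_omap; first exact: measurable_translate.
apply: measurable_opair.
  by apply: ih => w i wv; apply: mz => /=; exact: ltn_trans wv _.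
by apply: measurable_offspring => i; exact: mz.
Qed.

Section branching.
Context {R : realType} (alpha : R) (lam : {finite_measure set (pseq R) -> \bar R}).
Context d (Omega : measurableType d) (P : probability Omega R).
Variable xi : seq (nat * nat) -> nat -> Omega -> option (R * pseq R).
Hypothesis xi_family : branching_family P alpha lam xi.

Lemma xi_ppp u : poisson_point_process P (ppp_intensity alpha lam) (xi u).
Proof. by have [+ _] := xi_family; exact. Qed.

Lemma measurable_pos u :
  measurable_option (fun w => position (fun v i => xi v i w) u).
Proof.
by apply: measurable_position => v i _; exact: measurable_atom (xi_ppp v) i.
Qed.

Lemma measurable_off u c :
  measurable_option (fun w => offspring (fun i => xi u i w) c).
Proof.
by apply: measurable_offspring => i; exact: measurable_atom (xi_ppp u) i.
Qed.

(* The position of [v] is a function of the copies of N used by its strict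
   suffixes, which are shorter than [v]. *)
Lemma indep_pos_off v c (A B : set (R * R)) : measurable A -> measurable B ->
  let X w := position (fun v i => xi v i w) v in
  let Y w := offspring (fun i => xi v i w) c in
  P ((X @^-1` (Some @` A)) `&` (Y @^-1` (Some @` B))) =
  (P (X @^-1` (Some @` A)) * P (Y @^-1` (Some @` B)))%E.
Proof.
move=> mA mB X Y.
pose J := [set u : seq (nat * nat) | (size u < size v)%N].
have mxi u i : measurable_option (xi u i) by exact: measurable_atom (xi_ppp u) i.
have [_ indep] := xi_family.
apply: (indep_sigma_algebra _ _ _ indep (J := J) (v := v)).
- move=> u; apply: smallest_sub; first exact: sigma_algebra_measurable.
  by move=> _ [i [C mC ->]]; exact: mxi.
- by move=> u; exact: (@measurableT _ (g_sigma_algebraType _)).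
- by move=> u; exact: (@measurableI _ (g_sigma_algebraType _)).
- by rewrite /J /= ltnn.
(* [T'] is [Omega] with the sigma-algebra of the copies attached to shorter words. Measurability of
   the position over [T'] is exactly membership of the event in that sigma-algebra; the litter is
   treated alike with the single copy at [v]. *)
- pose T' := g_sigma_algebraType (\bigcup_(u in J) enum_events (xi u)).
  apply: (@measurable_position _ _ T' xi) => // u i uv C mC.
  apply: sub_sigma_algebra; exists u => //.
  by apply: sub_sigma_algebra; exists i, C.
- pose T' := g_sigma_algebraType
    [set E | exists i, exists2 C, measurable C & E = xi v i @^-1` (Some @` C)].
  apply: (@measurable_offspring _ _ T' (xi v)) => // i C mC.
  by apply: sub_sigma_algebra; exists i, C.
Qed.

Lemma integral_law_child v c (f : R * R -> \bar R) : (forall z, 0 <= f z)%E ->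
  measurable_fun setT f ->
  (\int[law P (measurable_pos (c :: v))]_z f z =
   \int[law P (measurable_pos v)]_z \int[law P (measurable_off v c)]_y
     f (z.1 + y.1, z.2 + y.2)%R)%E.
Proof.
move=> f0 mf; rewrite integral_law//.
rewrite -(integral_indep (measurable_pos v) (measurable_off v c)
  (f := fun z => f (z.1.1 + z.2.1, z.1.2 + z.2.2)))//.
- by apply: eq_integral => w _; rewrite position_cons; case: opair.
- by move=> A B mA mB; exact: indep_pos_off.
- exact: (measurableT_comp mf measurable_translate).
Qed.

End branching.

(** * The mean of the first generation *)

Section lebesgue_pos.
Context {R : realType}.
Local Open Scope ereal_scope.
Local Notation mu := (@lebesgue_measure R).

(* Lebesgue measure on (0, oo), carried by [R] itself rather than by the alias
   [measurableTypeR R], whose measure display is another one. *)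
Definition lebesgue_pos (A : set R) : \bar R :=
  mrestr mu (measurable_itv `]0%R, +oo[) A.

Let lebesgue_pos0 : lebesgue_pos set0 = 0.
Proof. exact: measure0. Qed.

Let lebesgue_pos_ge0 A : 0 <= lebesgue_pos A.
Proof. exact: measure_ge0. Qed.

Let lebesgue_pos_sigma_additive : semi_sigma_additive lebesgue_pos.
Proof. exact: (@measure_semi_sigma_additive _ _ _ (mrestr mu _)). Qed.

HB.instance Definition _ := isMeasure.Build _ _ _ lebesgue_pos
  lebesgue_pos0 lebesgue_pos_ge0 lebesgue_pos_sigma_additive.

Let lebesgue_pos_sigma_finite : sigma_finite setT lebesgue_pos.
Proof.
have /sigma_finiteP[F [TF _ Foo]] := sigma_finiteT mu.
exists F => // i; have [mFi Fi_oo] := Foo i; split => //.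
apply: le_lt_trans Fi_oo; rewrite /lebesgue_pos /mrestr.
by apply: le_measure; rewrite ?inE//; apply: measurableI => //; exact: measurable_itv.
Qed.

HB.instance Definition _ := Measure_isSigmaFinite.Build _ _ _ lebesgue_pos
  lebesgue_pos_sigma_finite.

Lemma integral_lebesgue_pos (f : R -> \bar R) : (forall x, 0 <= f x) ->
  measurable_fun setT f ->
  \int[lebesgue_pos]_x f x = \int[mu]_(x in `]0%R, +oo[) f x.
Proof.
move=> f0 mf.
transitivity (\int[mu]_(x in `]0%R, +oo[) \int[\d_(x : R)]_y f y); last first.
  by apply: eq_integral => x _; rewrite integral_dirac// diracT mul1e.
apply: integral_mixture => //.
- by move=> A mA; exact: measurable_fun_dirac.
- by move=> A mA; rewrite integral_indic//; exact: measurable_itv.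
Qed.

Lemma eq_integral_lebesgue_pos (f g : R -> \bar R) :
  (forall x, 0 <= f x) -> measurable_fun setT f ->
  (forall x, 0 <= g x) -> measurable_fun setT g ->
  (forall x, (0 < x)%R -> f x = g x) ->
  \int[lebesgue_pos]_x f x = \int[lebesgue_pos]_x g x.
Proof.
move=> f0 mf g0 mg fg; rewrite !integral_lebesgue_pos//.
by apply: eq_integral => x; rewrite inE /= in_itv /= andbT => /fg.
Qed.

End lebesgue_pos.

(** [m] is the mixture over [m2] of the images of [m1] on the slices at height y. This order of
    integration leaves [m2] arbitrary, as it must be for Lambda^*. *)
Lemma integral_product_measure2 d1 d2 (T1 : measurableType d1)
    (T2 : measurableType d2) (R : realType)
    (m1 : {sigma_finite_measure set T1 -> \bar R})
    (m2 : {measure set T2 -> \bar R}) (m : {measure set (T1 * T2) -> \bar R})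
    (f : T1 * T2 -> \bar R) :
  (forall A, measurable A -> m A = (m1 \x^ m2) A)%E ->
  (forall z, 0 <= f z)%E -> measurable_fun setT f ->
  (\int[m]_z f z = \int[m2]_y \int[m1]_x f (x, y))%E.
Proof.
move=> mE f0 mf.
pose slice y : {mfun T1 >-> (T1 * T2)%type} := HB.pack (pair^~ y)
  (isMeasurableFun.Build _ _ _ _ _ (@pair2_measurable _ _ T1 T2 y)).
rewrite (@integral_mixture _ _ _ _ _ m2 setT _ (fun y => pushforward m1 (slice y)))//.
- apply: eq_integral => y _; rewrite ge0_integral_pushforward//.
- move=> A mA; rewrite (_ : (fun y => _) = m1 \o ysection A).
    exact: measurable_fun_ysection.
  by apply/funext => y; rewrite /= /pushforward ysectionE.
- move=> A mA; rewrite mE//; apply: eq_integral => y _.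
  by rewrite /= /pushforward ysectionE.
Qed.

Lemma inv_pow_ge0 {R : realType} (alpha : R) (y : \bar R) :
  (0 <= inv_pow alpha y)%E.
Proof. by case: y => //= r; rewrite lee_fin powR_ge0. Qed.

Lemma measurable_inv_pow {R : realType} (alpha : R) k :
  measurable_fun setT (fun x : pseq R => inv_pow alpha (x k)).
Proof.
rewrite (_ : (fun x => _) = fun x : pseq R =>
    if x k \is a fin_num then ((fine (x k)) `^ (- alpha))%:E else 0%E).
  have mx := @measurable_coord R k.
  apply: measurable_fun_ifT => //.
    apply: (measurable_fun_bool true).
    exact: emeasurable_fin_num measurableT mx.
  have mfx : measurable_fun setT (fun x : pseq R => fine (x k)).
    exact: (measurableT_comp (fine_measurable measurableT) mx).
  apply/measurable_EFinP.
  exact: (measurableT_comp (measurable_powR (- alpha)) mfx).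
by apply/funext => x; case: (x k).
Qed.

Section campbell.
Context {R : realType} (alpha : R) (lam : {finite_measure set (pseq R) -> \bar R}).
Context d (Omega : measurableType d) (P : probability Omega R).
Variable xi : nat -> Omega -> option (R * pseq R).
Hypothesis ppp : poisson_point_process P (ppp_intensity alpha lam) xi.
Local Open Scope ereal_scope.

(** By [poisson_mean], the sum of the laws of the atoms is the intensity measure itself. *)
Lemma campbell (F : R * pseq R -> \bar R) : (forall z, 0 <= F z) ->
  measurable_fun setT F ->
  \esum_(i in setT) \int[law P (measurable_atom ppp i)]_z F z =
  \int[Lambda_star alpha lam]_x \int[lebesgue_pos]_t F (t, x).
Proof.
move=> F0 mF; rewrite -nneseries_esumT; last first.
  by move=> i; exact: integral_ge0.
rewrite -(@ge0_integral_measure_series _ _ _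
  (fun i => law P (measurable_atom ppp i)) setT)//.
apply: integral_product_measure2 => // A mA /=.
rewrite /mseries nneseries_esumT; last by move=> i; exact: measure_ge0.
rewrite poisson_mean//; apply: integral_ge0 => x _; exact: measure_ge0.
Qed.

End campbell.

(** * Scaling and translation of Lebesgue measure *)

Section lebesgue_affine.
Context {R : realType}.
Local Open Scope ereal_scope.
Local Notation mu := (@lebesgue_measure R).

(** Lebesgue measure is determined by the lengths of half-open intervals, on which the right side is
    computed directly. *)
Lemma lebesgue_measure_scale (c : R) (A : set R) : (0 < c)%R -> measurable A ->
  mu A = c%:E * mu ( *%R c @^-1` A).
Proof.
move=> c0 mA; have c0' : (0 <= c)%R by exact: ltW.
have mc : measurable_fun [set: measurableTypeR R]
    ( *%R c : measurableTypeR R -> measurableTypeR R).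
  exact: (@mulrl_measurable R setT c).
pose phi : {mfun measurableTypeR R >-> measurableTypeR R} := HB.pack ( *%R c)
  (isMeasurableFun.Build _ _ _ _ _ mc).
apply: (@lebesgue_measure_unique R (mscale (NngNum c0') (pushforward mu phi))) => //.
move=> _ [[a b] _ <-] /=.
transitivity (c%:E * mu `](c^-1 * a)%R, (c^-1 * b)%R]%classic); last first.
  rewrite /mscale /=; congr (_ * mu _).
  by apply/seteqP; split => x; rewrite /= !in_itv /= ltr_pdivrMl// ler_pdivlMl.
rewrite !lebesgue_measure_itv /= !lte_fin ltr_pM2l ?invr_gt0//.
case: ifPn => _; last by rewrite mule0.
by rewrite -!EFinB -EFinM -mulrBr mulrA mulfV ?mul1r// gt_eqF.
Qed.

Lemma lebesgue_measure_shift (a : R) (A : set R) : measurable A ->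
  mu A = mu (+%R a @^-1` A).
Proof.
move=> mA.
have ma : measurable_fun [set: measurableTypeR R]
    (+%R a : measurableTypeR R -> measurableTypeR R).
  exact: (@measurable_funD _ _ R setT (cst a) id).
pose phi : {mfun measurableTypeR R >-> measurableTypeR R} := HB.pack (+%R a)
  (isMeasurableFun.Build _ _ _ _ _ ma).
apply: (@lebesgue_measure_unique R (pushforward mu phi)) => //.
move=> _ [[u v] _ <-] /=.
transitivity (mu `](u - a)%R, (v - a)%R]%classic); last first.
  congr (mu _).
  by apply/seteqP; split => x; rewrite /= !in_itv /= ltrBlDl lerBrDl.
rewrite !lebesgue_measure_itv /= !lte_fin ltrD2r.
by case: ifPn => // _; rewrite -!EFinB opprB addrA subrK.
Qed.

Lemma integral_lebesgue_pos_scale (c : R) (f : R -> \bar R) : (0 < c)%R ->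
  (forall x, 0 <= f x) -> measurable_fun setT f ->
  c%:E * \int[lebesgue_pos]_x f (c * x)%R = \int[lebesgue_pos]_x f x.
Proof.
move=> c0 f0 mf; have c0' : (0 <= c)%R by exact: ltW.
pose phi : {mfun R >-> R} := HB.pack ( *%R c)
  (isMeasurableFun.Build _ _ _ _ _ (@mulrl_measurable R setT c)).
rewrite (_ : \int[_]_x f _ = \int[pushforward lebesgue_pos phi]_x f x); last first.
  by rewrite (ge0_integral_pushforward (measurable_funPT phi))//.
rewrite (_ : c%:E = (NngNum c0')%:num%:E)// -ge0_integral_mscale//.
apply: eq_measure_integral => A mA _.
rewrite /= /mscale /= /pushforward /lebesgue_pos /mrestr.
rewrite [RHS](@lebesgue_measure_scale c)//; last first.
  by apply: measurableI => //; exact: measurable_itv.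
congr (_ * mu _); apply/seteqP; split => x /=;
  rewrite !in_itv /= !andbT ?pmulr_rgt0//. Qed.

Lemma integral_lebesgue_pos_shift (a : R) (f : R -> \bar R) : (0 <= a)%R ->
  (forall x, 0 <= f x) -> measurable_fun setT f ->
  \int[lebesgue_pos]_x f (a + x)%R =
  \int[lebesgue_pos]_x (if (a < x)%R then f x else 0).
Proof.
move=> a0 f0 mf.
pose phi : {mfun R >-> R} := HB.pack (+%R a)
  (isMeasurableFun.Build _ _ _ _ _ (@measurable_funD _ _ R setT (cst a) id
    (measurable_cst _) (@measurable_id _ _ _))).
transitivity (\int[pushforward lebesgue_pos phi]_x f x).
  by rewrite (ge0_integral_pushforward (measurable_funPT phi))//.
have mD : measurable (`]a, +oo[%classic : set R) by exact: measurable_itv.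
transitivity (\int[mrestr lebesgue_pos mD]_x f x).
  apply: eq_measure_integral => A mA _.
  rewrite /= /mrestr /pushforward /lebesgue_pos /mrestr.
  rewrite [RHS](@lebesgue_measure_shift a)//; last first.
    by apply: measurableI; [exact: measurableI|exact: measurable_itv].
  congr (mu _); apply/seteqP; split => x /=; rewrite !in_itv /= !andbT.
    by move=> [Ax x0]; rewrite ltrDl x0 (le_lt_trans a0) ?ltrDl.
  by move=> [[]]; rewrite ltrDl.
rewrite integral_mrestr// integral_mkcond; apply: eq_integral => x _.
by rewrite patchE mem_setE in_itv /= andbT.
Qed.

End lebesgue_affine.

(** * Finite entries and the intensity of Z_1 *)

Section on_finite.
Context {R : realType}.
Local Open Scope ereal_scope.

(** Encodes that infinite entries are not atoms: they contribute 0. *)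
Definition on_finite (h : R -> \bar R) (y : \bar R) : \bar R :=
  if y is r%:E then h r else 0.

Lemma on_finite_ge0 h y : (forall r, 0 <= h r) -> 0 <= on_finite h y.
Proof. by move=> h0; case: y => /=. Qed.

Lemma measurable_on_finite d (T : measurableType d) (g : R * T -> \bar R)
    (y : T -> \bar R) : measurable_fun setT g -> measurable_fun setT y ->
  measurable_fun setT (fun t => on_finite (fun r => g (r, t)) (y t)).
Proof.
move=> mg my.
rewrite (_ : (fun t => _) = fun t =>
    if y t \is a fin_num then g (fine (y t), t) else 0).
  apply: measurable_fun_ifT => //.
    apply: (measurable_fun_bool true).
    exact: emeasurable_fin_num measurableT my.
  apply: (measurableT_comp mg); apply: measurable_fun_pair => //.
  exact: (measurableT_comp (fine_measurable measurableT) my).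
by apply/funext => t; case: (y t).
Qed.

End on_finite.

Section offspring_intensity.
Context {R : realType} (alpha : R) (lam : {finite_measure set (pseq R) -> \bar R}).
Context d (Omega : measurableType d) (P : probability Omega R).
Variable zeta : nat -> Omega -> option (R * pseq R).
Hypothesis ppp : poisson_point_process P (ppp_intensity alpha lam) zeta.
Local Open Scope ereal_scope.

Let measurable_density (phi : R -> \bar R) : measurable_fun setT phi ->
  measurable_fun setT (fun y => (y `^ (alpha - 1))%:E * phi y).
Proof.
move=> mphi; apply: emeasurable_funM => //.
by apply/measurable_EFinP; exact: measurable_powR.
Qed.

(** For finite [r] this is the substitution of [r * y] for y. For [r = +oo] and y > 0 the product is
    infinite, so both sides vanish: this is where the convention on the power of +oo enters. *)
Lemma integral_density_scale (phi : R -> \bar R) (r : \bar R) : 0 < r ->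
  (forall y, 0 <= phi y) -> measurable_fun setT phi ->
  \int[lebesgue_pos]_y ((y `^ (alpha - 1))%:E * on_finite phi (y%:E * r)) =
  inv_pow alpha r * \int[lebesgue_pos]_y ((y `^ (alpha - 1))%:E * phi y).
Proof.
move=> r0 phi0 mphi.
have dens0 y : 0 <= (y `^ (alpha - 1))%:E * phi y.
  by rewrite mule_ge0// lee_fin powR_ge0.
have mdens := measurable_density mphi.
have mfin : measurable_fun setT
    (fun y : R => (y `^ (alpha - 1))%:E * on_finite phi (y%:E * r)).
  apply: measurable_density.
  apply: (@measurable_on_finite _ _ R (phi \o fst) (fun y : R => y%:E * r)).
    exact: (measurableT_comp mphi measurable_fst).
  by apply: emeasurable_funM => //; exact/measurable_EFinP.
have fin0 y : 0 <= (y `^ (alpha - 1))%:E * on_finite phi (y%:E * r).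
  by rewrite mule_ge0// ?on_finite_ge0// lee_fin powR_ge0.
case: r r0 mfin fin0 => [r| |//] r0 mfin fin0; last first.
  rewrite mul0e (eq_integral_lebesgue_pos (g := cst 0))//.
    by rewrite integral0.
  by move=> y y0; rewrite gt0_muley ?lte_fin//= mule0.
rewrite lte_fin in r0.
have mr : measurable_fun setT (fun y : R => (r * y)%R).
  exact: (@mulrl_measurable R setT r).
rewrite /= -[in RHS](integral_lebesgue_pos_scale r0)// muleA.
rewrite (eq_integral_lebesgue_pos (f := fun x => ((r * x) `^ (alpha - 1))%:E * _)
  (g := fun y => (r `^ (alpha - 1))%:E *
    ((y `^ (alpha - 1))%:E * on_finite phi (y%:E * r%:E))))//; last 4 first.
- exact: (measurableT_comp mdens mr).
- by move=> y; rewrite mule_ge0// lee_fin powR_ge0.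
- exact: measurable_funeM.
- move=> y y0; rewrite muleA -EFinM -powRM ?(ltW r0) ?(ltW y0)//=.
  by rewrite (mulrC y).
rewrite ge0_integralZl//; last by rewrite lee_fin powR_ge0.
have rN : (r != 0)%R by rewrite gt_eqF.
(* The factor r is the Jacobian and [r ^ (alpha - 1)] comes from the density; together they account
   for [r ^ (- alpha)]. *)
have rr : (r `^ (- alpha) * r * r `^ (alpha - 1) = 1)%R.
  rewrite -{2}(powRr1 (ltW r0)) -!powRD ?rN ?implybT//.
  by rewrite -addrA subrKC addNr powRr0.
by rewrite muleA -!EFinM rr mul1e.
Qed.

(** Tonelli moves the integral over the scale y inside the one over [lam]; the scaling identity is
    then applied to each sequence separately. *)
Lemma integral_Lambda_star_coord (k : nat) (phi : R -> \bar R) :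
  (forall y, 0 <= phi y) -> measurable_fun setT phi ->
  \int[Lambda_star alpha lam]_x on_finite phi (seq_of x k) =
  (\int[lam]_x inv_pow alpha (seq_of x k)) *
  \int[lebesgue_pos]_y ((y `^ (alpha - 1))%:E * phi y).
Proof.
move=> phi0 mphi.
have mphi' d' (T' : measurableType d') (y : T' -> \bar R) :
    measurable_fun setT y -> measurable_fun setT (fun t => on_finite phi (y t)).
  move=> my; apply: (@measurable_on_finite _ _ T' (phi \o fst) y) => //.
  exact: (measurableT_comp mphi measurable_fst).
pose g (z : R * pseq R) :=
  (z.1 `^ (alpha - 1))%:E * on_finite phi (z.1%:E * seq_of z.2 k).
have g0 z : 0 <= g z.
  by rewrite mule_ge0// ?on_finite_ge0// lee_fin powR_ge0.
have mg : measurable_fun setT g.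
  apply: emeasurable_funM.
    apply/measurable_EFinP.
    exact: (measurableT_comp (measurable_powR (alpha - 1)) measurable_fst).
  apply: mphi'; apply: emeasurable_funM.
    by apply/measurable_EFinP; exact: measurable_fst.
  exact: (measurableT_comp (measurable_coord k) measurable_snd).
rewrite integral_Lambda_star; last 2 first.
- by move=> x; exact: on_finite_ge0.
- by apply: mphi'; exact: measurable_coord.
transitivity (\int[lebesgue_pos]_y \int[lam]_x g (y, x)).
  rewrite integral_lebesgue_pos//; last 2 first.
  - by move=> y; apply: integral_ge0 => x _; exact: g0.
  - exact: measurable_fun_fubini_tonelli_F.
  apply: eq_integral => y; rewrite inE /= in_itv /= andbT => y0.
  rewrite -ge0_integralZl//; last 3 first.
  - apply: mphi'.
    exact: (measurableT_comp (measurable_coord k) (measurable_pscaler y)).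
  - by move=> x _; exact: on_finite_ge0.
  - by rewrite lee_fin powR_ge0.
  by apply: eq_integral => x _; rewrite /g /= pscaleE.
rewrite (fubini_tonelli g)//.
rewrite -ge0_integralZr//; last 3 first.
- exact: measurable_inv_pow.
- by move=> x _; exact: inv_pow_ge0.
- by apply: integral_ge0 => y _; rewrite mule_ge0// lee_fin powR_ge0.
apply: eq_integral => x _; rewrite /g /= integral_density_scale//.
by have [+ _ _ _] := pseqP x; exact.
Qed.

(** For each rank k, Campbell's formula sums over the atoms i of N; the sum over k then assembles
    [c_lambda]. The labels (i, k) are swapped first to put k outside. *)
Lemma offspring_intensity (f : R * R -> \bar R) : (forall z, 0 <= f z) ->
  measurable_fun setT f ->
  \esum_(c in setT) \int[P]_w oapp f 0 (offspring (fun i => zeta i w) c) =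
  c_lambda alpha lam * \int[lebesgue_pos]_y
    ((y `^ (alpha - 1))%:E * \int[lebesgue_pos]_s f (s, y)).
Proof.
move=> f0 mf.
pose phi y := \int[lebesgue_pos]_s f (s, y).
have phi0 y : 0 <= phi y by exact: integral_ge0.
have mphi : measurable_fun setT phi by exact: measurable_fun_fubini_tonelli_G.
pose G k (z : R * pseq R) := on_finite (fun r => f (z.1, r)) (seq_of z.2 k).
have G0 k z : 0 <= G k z by exact: on_finite_ge0.
have mG k : measurable_fun setT (G k).
  apply: (@measurable_on_finite _ _ _ (fun z : R * (R * pseq R) => f (z.2.1, z.1))).
    apply: (measurableT_comp mf); apply: measurable_fun_pair => //.
    exact: (measurableT_comp measurable_fst measurable_snd).
  exact: (measurableT_comp (measurable_coord k) measurable_snd).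
rewrite (reindex_esum [set: nat * nat] setT (fun p => (p.2, p.1))); last first.
  split => //; first by move=> [i k] [j l] _ _ [-> ->].
  by move=> [i k] _; exists (k, i).
rewrite [X in \esum_(i in X) _](_ : _ = setT `*`` (fun=> setT)); last first.
  by apply/seteqP; split.
rewrite -(@esum_esum _ _ _ setT (fun=> setT) (fun k i =>
  \int[P]_w oapp f 0 (offspring (zeta^~ w) (i, k)))); last first.
  by move=> k i _ _; apply: integral_ge0 => w _; case: offspring.
transitivity (\esum_(k in [set: nat]) ((\int[lam]_x inv_pow alpha (seq_of x k)) *
    \int[lebesgue_pos]_y ((y `^ (alpha - 1))%:E * phi y))).
  apply: eq_esum => k _.
  rewrite -integral_Lambda_star_coord//.
  transitivity (\esum_(i in [set: nat])
      \int[law P (measurable_atom ppp i)]_z G k z).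
    apply: eq_esum => i _; rewrite integral_law//; apply: eq_integral => w _.
    rewrite /offspring /=; case: (zeta i w) => [[t x]|] //=.
    by rewrite /G /=; case: (seq_of x k).
  rewrite campbell//; apply: eq_integral => x _; rewrite /G /phi.
  by case: (seq_of x k) => //=; rewrite integral0.
under eq_esum do rewrite muleC.
rewrite esum_countableZl; last 2 first.
- by move=> k; apply: integral_ge0 => x _; exact: inv_pow_ge0.
- by apply: integral_ge0 => y _; rewrite mule_ge0// lee_fin powR_ge0.
rewrite muleC /c_lambda integral_nneseries//; last 2 first.
- by move=> k; exact: measurable_inv_pow.
- by move=> k x _; exact: inv_pow_ge0.
by rewrite nneseries_esumT// => k; apply: integral_ge0 => x _; exact: inv_pow_ge0.
Qed.

End offspring_intensity.

(** * The mean of the n-th generation *)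

Section step.
Context {R : realType} (alpha : R) (c : \bar R).
Hypothesis c0 : (0 <= c)%E.
Local Open Scope ereal_scope.

(* [step f z] is the integral of [f (z + w)] against the mean measure of Z_1, for
   [c = c_lambda alpha lam]; see [offspring_intensity]. *)
Definition step (f : R * R -> \bar R) (z : R * R) : \bar R :=
  c * \int[lebesgue_pos]_y ((y `^ (alpha - 1))%:E *
        \int[lebesgue_pos]_s f (z.1 + s, z.2 + y)%R).

Lemma step_ge0 f z : (forall z, 0 <= f z) -> 0 <= step f z.
Proof.
move=> f0; rewrite mule_ge0//; apply: integral_ge0 => y _.
by rewrite mule_ge0 ?lee_fin ?powR_ge0//; exact: integral_ge0.
Qed.

Let measurable_step2 f : (forall z, 0 <= f z) -> measurable_fun setT f ->
  measurable_fun [set: (R * R) * R] (fun p => (p.2 `^ (alpha - 1))%:E *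
    \int[lebesgue_pos]_s f (p.1.1 + s, p.1.2 + p.2)%R).
Proof.
move=> f0 mf; apply: emeasurable_funM.
  apply/measurable_EFinP.
  exact: (measurableT_comp (measurable_powR (alpha - 1)) measurable_snd).
apply: (measurable_fun_fubini_tonelli_F (m2 := @lebesgue_pos R)
  (fun q : ((R * R) * R) * R => f (q.1.1.1 + q.2, q.1.1.2 + q.1.2)%R)) => //.
apply: (measurableT_comp mf); apply: measurable_fun_pair;
    apply: measurable_funD => //.
- exact: (measurableT_comp measurable_fst (measurableT_comp measurable_fst
    measurable_fst)).
- exact: (measurableT_comp measurable_snd (measurableT_comp measurable_fst
    measurable_fst)).
- exact: (measurableT_comp measurable_snd measurable_fst).
Qed.

Lemma measurable_step f : (forall z, 0 <= f z) -> measurable_fun setT f ->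
  measurable_fun setT (step f).
Proof.
move=> f0 mf; apply: emeasurable_funM => //.
apply: (measurable_fun_fubini_tonelli_F (m2 := @lebesgue_pos R) (fun p : (R * R) * R =>
  (p.2 `^ (alpha - 1))%:E *
    \int[lebesgue_pos]_s f (p.1.1 + s, p.1.2 + p.2)%R)).
  exact: measurable_step2.
by move=> p; rewrite mule_ge0 ?lee_fin ?powR_ge0//; exact: integral_ge0.
Qed.

Definition quadrant : set (R * R) := [set z | (0 <= z.1 /\ 0 <= z.2)%R].

(** From a point of the quadrant, almost every displacement charged by the mean of Z_1 leads to a
    point of the quadrant. *)
Lemma eq_step f g : (forall z, 0 <= f z) -> measurable_fun setT f ->
  (forall z, 0 <= g z) -> measurable_fun setT g ->
  {in quadrant, f =1 g} -> {in quadrant, step f =1 step g}.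
Proof.
move=> f0 mf g0 mg fg z; rewrite inE => -[z1 z2].
have mslice h y : measurable_fun setT h ->
    measurable_fun setT (fun s : R => h (z.1 + s, z.2 + y)%R : \bar R).
  move=> mh; apply: (measurableT_comp mh); apply: measurable_fun_pair => //.
  exact: measurable_funD.
congr (c * _); apply: eq_integral_lebesgue_pos.
- by move=> y; rewrite mule_ge0 ?lee_fin ?powR_ge0//; exact: integral_ge0.
- exact: (measurableT_comp (measurable_step2 f0 mf) (pair1_measurable z)).
- by move=> y; rewrite mule_ge0 ?lee_fin ?powR_ge0//; exact: integral_ge0.
- exact: (measurableT_comp (measurable_step2 g0 mg) (pair1_measurable z)).
- move=> y y0; congr (_ * _); apply: eq_integral_lebesgue_pos => //.
  + exact: mslice.
  + exact: mslice.
  + by move=> s s0; apply: fg; rewrite inE; split; rewrite /= addr_ge0// ltW.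
Qed.

End step.

Lemma c_lambda_ge0 {R : realType} (alpha : R)
    (lam : {measure set (pseq R) -> \bar R}) : (0 <= c_lambda alpha lam)%E.
Proof.
by apply: integral_ge0 => x _; apply: nneseries_ge0 => k _ _; exact: inv_pow_ge0.
Qed.

Section mean_measure.
Context {R : realType} (alpha : R) (lam : {finite_measure set (pseq R) -> \bar R}).
Context d (Omega : measurableType d) (P : probability Omega R).
Variable xi : seq (nat * nat) -> nat -> Omega -> option (R * pseq R).
Hypothesis xi_family : branching_family P alpha lam xi.
Local Open Scope ereal_scope.
Local Notation step := (step alpha (c_lambda alpha lam)).

(* The integral of [f] against the mean measure of Z_n. *)
Definition mean_brw n (f : R * R -> \bar R) : \bar R :=
  \esum_(u in [set: n.-tuple (nat * nat)])
    \int[law P (measurable_pos xi_family u)]_z f z.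

Let c_ge0 : 0 <= c_lambda alpha lam := c_lambda_ge0 alpha lam.

Lemma mean_brw0 f : (forall z, 0 <= f z) -> measurable_fun setT f ->
  mean_brw 0 f = f (0, 0)%R.
Proof.
move=> f0 mf; rewrite /mean_brw (_ : setT = [set [tuple]]).
  rewrite esum_set1; last exact: integral_ge0.
  by rewrite integral_law//= integral_cst// [X in _ * X](probability_setT P) mule1.
by apply/seteqP; split => // u _; exact: tuple0.
Qed.

(** A word of length n + 1 is a parent together with its most recent letter. Summing over that
    letter with the parent's position z fixed turns [f] into [step f z]. *)
Lemma mean_brwS n f : (forall z, 0 <= f z) -> measurable_fun setT f ->
  mean_brw n.+1 f = mean_brw n (step f).
Proof.
move=> f0 mf; rewrite /mean_brw.
rewrite (reindex_esum [set: n.-tuple (nat * nat) * (nat * nat)] setT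
  (fun p => cons_tuple p.2 p.1)); last first.
  split => //.
    by move=> [u c] [v e] _ _ /= /(congr1 val) /= [-> /val_inj ->].
  by move=> u _; exists (behead_tuple u, thead u); rewrite // [RHS]tuple_eta.
rewrite [X in \esum_(i in X) _](_ : _ = setT `*`` (fun=> setT)); last first.
  by apply/seteqP; split.
rewrite -(@esum_esum _ _ _ setT (fun=> setT) (fun u c =>
  \int[law P (measurable_pos xi_family (cons_tuple c u))]_z f z)); last first.
  by move=> u c _ _; exact: integral_ge0.
apply: eq_esum => v _.
have mshift : measurable_fun [set: (R * R) * (R * R)]
    (fun z => f (z.1.1 + z.2.1, z.1.2 + z.2.2)%R).
  exact: (measurableT_comp mf measurable_translate).
under eq_esum do rewrite integral_law_child//.
rewrite -integral_esum//; last 2 first.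
- move=> c; apply: (measurable_fun_fubini_tonelli_F
    (m2 := law P (measurable_off xi_family v c))
    (fun z : (R * R) * (R * R) => f (z.1.1 + z.2.1, z.1.2 + z.2.2)%R)) => //.
- by move=> c z; exact: integral_ge0.
apply: eq_integral => z _.
have mz : measurable_fun setT (fun y : R * R => f (z.1 + y.1, z.2 + y.2)%R).
  exact: (measurableT_comp mshift (pair1_measurable z)).
pose fz (y : R * R) := f (z.1 + y.1, z.2 + y.2)%R.
transitivity (\esum_(c in [set: nat * nat])
    \int[P]_w oapp fz 0 (offspring (fun i => xi v i w) c)).
  by apply: eq_esum => c _; rewrite integral_law.
have fz0 y : 0 <= fz y by exact: f0.
have := offspring_intensity (xi_ppp xi_family v) fz0 mz.
move=> ->.
reflexivity.
Qed.

(* Positions lie in the quadrant only almost surely: on a null event an atom of a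
   copy of N may have a nonpositive time. *)
Lemma eq_mean_brw n f g : (forall z, 0 <= f z) -> measurable_fun setT f ->
  (forall z, 0 <= g z) -> measurable_fun setT g ->
  {in quadrant, f =1 g} -> mean_brw n f = mean_brw n g.
Proof.
elim: n f g => [|n ih] f g f0 mf g0 mg fg.
  by rewrite !mean_brw0// fg// inE; split => /=.
rewrite (mean_brwS n f0 mf) (mean_brwS n g0 mg); apply: ih.
- by move=> z; exact: step_ge0.
- exact: measurable_step.
- by move=> z; exact: step_ge0.
- exact: measurable_step.
- exact: eq_step.
Qed.

(** The functions [F m] are closed forms of the iterates of [step], correct on the quadrant. The
    induction passes to the family of the [step (F m)], which satisfies the same hypotheses by
    [eq_step]. *)
Lemma mean_brw_iter n (F : nat -> R * R -> \bar R) :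
  (forall m z, 0 <= F m z) -> (forall m, measurable_fun setT (F m)) ->
  (forall m, {in quadrant, step (F m) =1 F m.+1}) ->
  mean_brw n (F 0%N) = F n (0, 0)%R.
Proof.
elim: n F => [|n ih] F F0 mF stepF; first by rewrite mean_brw0.
rewrite (mean_brwS n (F0 0%N) (mF 0%N)) (ih (fun m => step (F m))).
- by apply: stepF; rewrite inE; split => /=.
- by move=> m z; exact: step_ge0.
- by move=> m; exact: measurable_step.
- by move=> m; apply: eq_step => //; [move=> z; exact: step_ge0|exact: measurable_step].
Qed.

End mean_measure.

(** * Gamma and beta integrals *)

Section gamma_beta.
Context {R : realType}.
Local Open Scope ereal_scope.
Implicit Types a b u : R.

(** The truncated power. Since 0 to the power 0 is 1 and the test is weak, [pos_pow 0] is the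
    indicator of [0,oo), endpoint included; the sequences of test functions start there. *)
Definition pos_pow b u : R := if (0 <= u)%R then (u `^ b)%R else 0%R.

Lemma pos_pow_ge0 b u : (0 <= pos_pow b u)%R.
Proof. by rewrite /pos_pow; case: ifPn => // _; exact: powR_ge0. Qed.

Lemma measurable_pos_pow b : measurable_fun setT (pos_pow b).
Proof.
by apply: measurable_fun_ifT => //; exact: measurable_fun_ler.
Qed.

Lemma measurable_pos_powB b u : measurable_fun setT (fun y : R => pos_pow b (u - y)).
Proof.
apply: (measurableT_comp (measurable_pos_pow b)).
exact: measurable_funB.
Qed.

Lemma pos_powM b u v : (0 < u)%R -> pos_pow b (u * v) = (u `^ b * pos_pow b v)%R.
Proof.
move=> u0; rewrite /pos_pow pmulr_rge0//; case: ifPn => v0; last by rewrite mulr0.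
by rewrite powRM// ltW.
Qed.

(* [Gamma a] is [fine (gamma_int a)], thus [0] if Euler's integral diverges. *)
Definition gamma_int a : \bar R :=
  \int[lebesgue_pos]_t (t `^ (a - 1) * expR (- t))%:E.

(** Euler's beta function at (a, b + 1): the second exponent is not shifted. *)
Definition beta_int a b : \bar R :=
  \int[lebesgue_pos]_z (z `^ (a - 1) * pos_pow b (1 - z))%:E.

Lemma measurable_gamma_integrand a :
  measurable_fun setT (fun t : R => t `^ (a - 1) * expR (- t))%R.
Proof.
apply: measurable_funM; first exact: measurable_powR.
by apply: (measurableT_comp (@measurable_expR R)); exact: measurable_funN.
Qed.

Lemma measurable_beta_integrand a b u :
  measurable_fun setT (fun z : R => z `^ (a - 1) * pos_pow b (u - z))%R.
Proof.
apply: measurable_funM; first exact: measurable_powR.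
exact: measurable_pos_powB.
Qed.

Lemma gamma_int_ge0 a : 0 <= gamma_int a.
Proof.
by apply: integral_ge0 => t _; rewrite lee_fin mulr_ge0 ?powR_ge0 ?expR_ge0.
Qed.

Lemma beta_int_ge0 a b : 0 <= beta_int a b.
Proof.
by apply: integral_ge0 => t _; rewrite lee_fin mulr_ge0 ?powR_ge0 ?pos_pow_ge0.
Qed.

Lemma GammaE a : Gamma a = fine (gamma_int a).
Proof.
rewrite /Gamma /Rintegral /gamma_int integral_lebesgue_pos//.
- by move=> t; rewrite lee_fin mulr_ge0 ?powR_ge0 ?expR_ge0.
- by apply/measurable_EFinP; exact: measurable_gamma_integrand.
Qed.

(** The substitution of [theta * y] for t in Euler's integral, valid also when that integral
    diverges. *)
Lemma laplace_density a theta x : (0 < theta)%R ->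
  \int[lebesgue_pos]_y ((y `^ (a - 1))%:E * (expR (- (theta * (x + y))))%:E) =
  (theta `^ (- a) * expR (- (theta * x)))%:E * gamma_int a.
Proof.
move=> th0.
have int0 (t : R) : 0 <= (t `^ (a - 1) * expR (- t))%:E.
  by rewrite lee_fin mulr_ge0 ?powR_ge0 ?expR_ge0.
have mint := measurable_gamma_integrand a.
have mth : measurable_fun setT (fun y : R => theta * y)%R.
  exact: (@mulrl_measurable R setT theta).
have mintE : measurable_fun setT
    (fun t : R => (t `^ (a - 1) * expR (- t))%:E) by exact/measurable_EFinP.
rewrite /gamma_int -(integral_lebesgue_pos_scale th0 int0 mintE).
rewrite muleA -ge0_integralZl//; last 2 first.
- by apply/measurable_EFinP; exact: (measurableT_comp mint mth).
- by rewrite mule_ge0// lee_fin ?mulr_ge0 ?powR_ge0 ?expR_ge0 ?ltW.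
have thN : (theta != 0)%R by rewrite gt_eqF.
apply: eq_integral_lebesgue_pos.
- by move=> y; rewrite -EFinM lee_fin mulr_ge0 ?powR_ge0 ?expR_ge0.
- apply: emeasurable_funM.
    by apply/measurable_EFinP; exact: measurable_powR.
  apply/measurable_EFinP; apply: (measurableT_comp (@measurable_expR R)).
  apply: measurable_funN; apply: measurable_funM => //.
  exact: measurable_funD.
- by move=> y; rewrite -!EFinM lee_fin !mulr_ge0 ?powR_ge0 ?expR_ge0// ltW.
- apply: measurable_funeM; apply/measurable_EFinP.
  exact: (measurableT_comp mint mth).
- move=> y y0; rewrite -!EFinM; congr (_%:E).
  have tt : (theta `^ (- a) * theta * theta `^ (a - 1) = 1)%R.
    rewrite -{2}(powRr1 (ltW th0)) -!powRD ?thN ?implybT//.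
    by rewrite -addrA subrKC addNr powRr0.
  rewrite mulrDr opprD expRD (powRM _ (ltW th0) (ltW y0)).
  transitivity ((theta `^ (- a) * theta * theta `^ (a - 1)) *
    (y `^ (a - 1) * (expR (- (theta * x)) * expR (- (theta * y)))))%R.
    by rewrite tt mul1r.
  by ring.
Qed.

(* Both sides vanish for [u < 0]; for [u > 0] this is homogeneity. *)
Lemma beta_convolution a b u : (0 < a)%R -> (0 <= b)%R ->
  \int[lebesgue_pos]_y ((y `^ (a - 1))%:E * (pos_pow b (u - y))%:E) =
  beta_int a b * (pos_pow (a + b) u)%:E.
Proof.
move=> a0 b0; under eq_integral do rewrite -EFinM.
have int0 v (t : R) : 0 <= (t `^ (a - 1) * pos_pow b (v - t))%:E.
  by rewrite lee_fin mulr_ge0 ?powR_ge0 ?pos_pow_ge0.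
have mint v := measurable_beta_integrand a b v.
have mintE v : measurable_fun setT
  (fun t : R => (t `^ (a - 1) * pos_pow b (v - t))%:E) by exact/measurable_EFinP.
have [u0|u0] := leP u 0%R.
  rewrite (eq_integral_lebesgue_pos (g := cst 0) (int0 u) (mintE u))//; last first.
    move=> y y0; rewrite /pos_pow ifF ?mulr0//.
    by apply/negbTE; rewrite -ltNge (lt_le_trans _ u0)// ltrBlDr ltrDl.
  rewrite integral0 /pos_pow; case: ifPn => [u0'|_]; last by rewrite mule0.
  (* At the endpoint [u = 0], the right side vanishes because [a + b] is positive. *)
  rewrite (_ : u = 0%R) ?powR0 ?mule0//; last by apply/eqP; rewrite eq_le u0.
  by rewrite gt_eqF// ltr_wpDr.
rewrite -(integral_lebesgue_pos_scale u0 (int0 u) (mintE u)).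
rewrite [pos_pow (a + b) u]/pos_pow (ltW u0) muleC.
have mu_ : measurable_fun setT (fun y : R => u * y)%R.
  exact: (@mulrl_measurable R setT u).
have uN : (u != 0)%R by rewrite gt_eqF.
rewrite (eq_integral_lebesgue_pos (g := fun z =>
   (u `^ (a - 1) * u `^ b)%:E * (z `^ (a - 1) * pos_pow b (1 - z))%:E))//; last 4 first.
- by apply/measurable_EFinP; exact: (measurableT_comp (mint u) mu_).
- by move=> z; rewrite -EFinM lee_fin !mulr_ge0 ?powR_ge0 ?pos_pow_ge0.
- by apply: measurable_funeM; exact/measurable_EFinP.
- move=> z z0; rewrite -EFinM; congr (_%:E).
  rewrite -{2}[u]mulr1 -mulrBr pos_powM// (powRM _ (ltW u0) (ltW z0)).
  by ring.
rewrite ge0_integralZl//; last by rewrite lee_fin mulr_ge0 ?powR_ge0.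
rewrite muleC muleA -EFinM [RHS]muleC; congr (_%:E * _).
rewrite -{1}(powRr1 (ltW u0)) -!powRD ?uN ?implybT//.
by rewrite addrA subrKC.
Qed.

End gamma_beta.

(** A point is a null set. This absorbs the mismatch between the weak cut-off in [pos_pow] and the
    strict one produced by a translation of (0,oo), which is visible at exponent 0. *)
Lemma eq_integral_lebesgue_posD1 {R : realType} (r : R) (f g : R -> \bar R) :
  (forall x, 0 <= f x)%E -> measurable_fun setT f ->
  (forall x, 0 <= g x)%E -> measurable_fun setT g ->
  (forall x, 0 < x -> x != r -> f x = g x) ->
  (\int[lebesgue_pos]_x f x = \int[lebesgue_pos]_x g x)%E.
Proof.
move=> f0 mf g0 mg fg; rewrite !integral_lebesgue_pos//.
have mD : measurable (`]0, +oo[ `\ r : set (measurableTypeR R)).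
  by apply: measurableD => //; exact: measurable_itv.
rewrite -(@integral_setD1 _ f r)//; last exact: (measurable_funTS mf).
rewrite -(@integral_setD1 _ g r)//; last exact: (measurable_funTS mg).
apply: eq_integral => x; rewrite inE /= in_itv /= andbT => -[x0 /eqP xr].
exact: fg.
Qed.

Section gamma_beta_identity.
Context {R : realType}.
Local Open Scope ereal_scope.
Implicit Types a b y : R.

Lemma laplace_pos_pow b y : (0 < y)%R ->
  \int[lebesgue_pos]_u (expR (- u) * pos_pow b (u - y))%:E =
  (expR (- y))%:E * gamma_int (b + 1).
Proof.
move=> y0; pose f (u : R) := (expR (- u) * pos_pow b (u - y))%:E.
have f0 u : 0 <= f u by rewrite lee_fin mulr_ge0 ?expR_ge0 ?pos_pow_ge0.
have mf : measurable_fun setT f.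
  apply/measurable_EFinP; apply: measurable_funM.
    by apply: (measurableT_comp (@measurable_expR R)); exact: measurable_funN.
  apply: (measurableT_comp (measurable_pos_pow b)).
  exact: measurable_funB.
have -> : \int[lebesgue_pos]_u f u =
    \int[lebesgue_pos]_u (if (y < u)%R then f u else 0).
  apply: (eq_integral_lebesgue_posD1 (r := y)) => //.
  - by move=> u; case: ifPn.
  - by apply: measurable_fun_ifT => //; exact: measurable_fun_ltr.
  - move=> u _ uy; case: ltP => // uy'.
    rewrite /f /pos_pow ifF ?mulr0//; apply/negbTE.
    by rewrite subr_ge0 -ltNge lt_neqAle uy uy'.
rewrite -(integral_lebesgue_pos_shift (ltW y0))// /gamma_int -ge0_integralZl//;
  last 2 first.
- by apply/measurable_EFinP; exact: measurable_gamma_integrand.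
- by move=> v _; rewrite lee_fin mulr_ge0 ?powR_ge0 ?expR_ge0.
apply: eq_integral_lebesgue_pos => //.
- apply: (measurableT_comp mf); exact: measurable_funD.
- by move=> v; rewrite -EFinM lee_fin !mulr_ge0 ?expR_ge0 ?powR_ge0.
- by apply: measurable_funeM; apply/measurable_EFinP; exact: measurable_gamma_integrand.
- move=> v v0; rewrite /f -EFinM addrAC subrr add0r addrK /pos_pow (ltW v0).
  by rewrite opprD expRD; congr (_%:E); ring.
Qed.

(** The integral of [e^(-u) y^(a-1) (u-y)_+^b] over u and y is computed in both orders. The identity
    holds in [0,+oo] and can therefore serve to prove finiteness. *)
Lemma gamma_beta a b : (0 < a)%R -> (0 <= b)%R ->
  beta_int a b * gamma_int (a + b + 1) = gamma_int a * gamma_int (b + 1).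
Proof.
move=> a0 b0.
pose h (z : R * R) := (z.2 `^ (a - 1))%:E * (expR (- z.1) * pos_pow b (z.1 - z.2))%:E.
have h0 z : 0 <= h z.
  by rewrite /h -EFinM lee_fin !mulr_ge0 ?expR_ge0 ?powR_ge0 ?pos_pow_ge0.
have mh : measurable_fun setT h.
  apply: emeasurable_funM; apply/measurable_EFinP.
    exact: (measurableT_comp (measurable_powR (a - 1)) measurable_snd).
  apply: measurable_funM.
    apply: (measurableT_comp (@measurable_expR R)).
    apply: measurable_funN; exact: measurable_fst.
  apply: (measurableT_comp (measurable_pos_pow b)).
  by apply: measurable_funB; [exact: measurable_fst|exact: measurable_snd].
transitivity (\int[lebesgue_pos]_u \int[lebesgue_pos]_y h (u, y)).
  rewrite /gamma_int -ge0_integralZl//; last 3 first.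
  - by apply/measurable_EFinP; exact: measurable_gamma_integrand.
  - by move=> u _; rewrite lee_fin mulr_ge0 ?powR_ge0 ?expR_ge0.
  - exact: beta_int_ge0.
  apply: eq_integral_lebesgue_pos.
  - move=> u; rewrite mule_ge0 ?beta_int_ge0// lee_fin.
    by rewrite mulr_ge0 ?powR_ge0 ?expR_ge0.
  - apply: measurable_funeM.
    by apply/measurable_EFinP; exact: measurable_gamma_integrand.
  - by move=> u; exact: integral_ge0.
  - exact: measurable_fun_fubini_tonelli_F.
  - move=> u u0; rewrite /h /=.
    under [RHS]eq_integral do rewrite -?EFinM mulrCA EFinM.
    rewrite ge0_integralZl//; last 2 first.
    + by apply/measurable_EFinP; exact: measurable_beta_integrand.
    + by move=> y _; rewrite lee_fin mulr_ge0 ?powR_ge0 ?pos_pow_ge0.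
    under [X in _ = _ * X]eq_integral do rewrite EFinM.
    rewrite beta_convolution// /pos_pow (ltW u0) addrK muleCA -EFinM.
    by rewrite mulrC.
rewrite (fubini_tonelli h)//.
rewrite muleC {2}/gamma_int -ge0_integralZl//; last 3 first.
- by apply/measurable_EFinP; exact: measurable_gamma_integrand.
- by move=> u _; rewrite lee_fin mulr_ge0 ?powR_ge0 ?expR_ge0.
- exact: gamma_int_ge0.
apply: eq_integral_lebesgue_pos.
- by move=> u; exact: integral_ge0.
- exact: measurable_fun_fubini_tonelli_G.
- move=> y; rewrite mule_ge0 ?gamma_int_ge0// lee_fin.
  by rewrite mulr_ge0 ?powR_ge0 ?expR_ge0.
- apply: measurable_funeM.
  by apply/measurable_EFinP; exact: measurable_gamma_integrand.
- move=> y y0; rewrite /h /= ge0_integralZl//; last 3 first.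
  + apply/measurable_EFinP; apply: measurable_funM.
      by apply: (measurableT_comp (@measurable_expR R)); exact: measurable_funN.
    apply: (measurableT_comp (measurable_pos_pow b)).
    exact: measurable_funB.
  + by move=> u _; rewrite lee_fin mulr_ge0 ?expR_ge0 ?pos_pow_ge0.
  + by rewrite lee_fin powR_ge0.
  by rewrite laplace_pos_pow// muleA -EFinM muleC.
Qed.

(** On [1,2] the power is at least 1 and the exponential at least [e^(-2)]. The bound is uniform in
    [a]; it gives positivity and the convergence of the Wright series. *)
Lemma gamma_int_ge_expN2 a : (1 <= a)%R -> (expR (- 2))%:E <= gamma_int a.
Proof.
move=> a1; rewrite /gamma_int integral_lebesgue_pos; last 2 first.
- by move=> t; rewrite lee_fin mulr_ge0 ?powR_ge0 ?expR_ge0.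
- by apply/measurable_EFinP; exact: measurable_gamma_integrand.
have m12 : measurable (`[1%R, 2%R]%classic : set (measurableTypeR R)).
  exact: measurable_itv.
have -> : (expR (- 2))%:E =
    \int[@lebesgue_measure R]_(t in `[1%R, 2%R]) (cst (expR (- 2))%:E t).
  rewrite integral_cst//= lebesgue_measure_itv /= lte_fin ltr1n -EFinB.
  by rewrite (_ : 2 - 1 = 1 :> R)%R ?mule1//; ring.
have mg : measurable_fun [set: measurableTypeR R]
    (fun t : R => (t `^ (a - 1) * expR (- t))%:E).
  by apply/measurable_EFinP; exact: measurable_gamma_integrand.
apply: (@le_trans _ _ (\int[@lebesgue_measure R]_(t in `[1%R, 2%R])
    (t `^ (a - 1) * expR (- t))%:E)).
  apply: (ge0_le_integral _ m12).
  - by move=> t _; rewrite lee_fin expR_ge0.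
  - exact: measurable_cst.
  - exact: (measurable_funTS mg).
  - move=> t; rewrite /= in_itv /= lee_fin => /andP[t1 t2].
    have ta : (t `^ 0 <= t `^ (a - 1))%R by rewrite ler_powR// subr_ge0.
    rewrite powRr0 in ta.
    by rewrite -[leLHS]mul1r ler_pM ?expR_ge0// ler_expR lerN2.
apply: (ge0_subset_integral _ m12).
- exact: measurable_itv.
- exact: (measurable_funTS mg).
- by move=> t _; rewrite lee_fin mulr_ge0 ?powR_ge0 ?expR_ge0.
- move=> t; rewrite /= !in_itv /= andbT => /andP[t1 _].
  exact: lt_le_trans t1.
Qed.

(** The total mass of the exponential law of rate 1. *)
Lemma gamma_int1 : gamma_int (1 : R) = 1.
Proof.
rewrite /gamma_int integral_lebesgue_pos; last 2 first.
- by move=> t; rewrite lee_fin mulr_ge0 ?powR_ge0 ?expR_ge0.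
- by apply/measurable_EFinP; exact: measurable_gamma_integrand.
rewrite -(@integral_exponential_pdf R 1 ltr01).
rewrite integral_itv_obnd_cbnd; last first.
  apply: (@measurable_funTS _ _ (measurableTypeR R)).
  by apply/measurable_EFinP; exact: measurable_gamma_integrand.
rewrite integral_mkcond; apply: eq_integral => t _.
rewrite /exponential_pdf !patchE; case: ifPn => // _.
by rewrite subrr powRr0 mulN1r.
Qed.

(** The constant produced by each convolution in the time coordinate. *)
Lemma beta_int1n n : beta_int 1 n%:R = (n.+1%:R^-1 : R)%:E.
Proof.
rewrite -Rintegral_onemXn /Rintegral fineK; last first.
  rewrite (_ : (fun x => _) = EFin \o XMonemX 0 n); last first.
    by apply/funext => x; rewrite /= XMonemX0n.
  apply: (integrable_fin_num _ (integrable_XMonemX 0 n)); exact: measurable_itv.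
rewrite /beta_int integral_lebesgue_pos; last 2 first.
- by move=> t; rewrite lee_fin mulr_ge0 ?powR_ge0 ?pos_pow_ge0.
- by apply/measurable_EFinP; exact: measurable_beta_integrand.
rewrite integral_itv_obnd_cbnd; last first.
  apply: (@measurable_funTS _ _ (measurableTypeR R)).
  by apply/measurable_EFinP; exact: measurable_beta_integrand.
rewrite [LHS]integral_mkcond [RHS]integral_mkcond; apply: eq_integral => t _.
rewrite !patchE !mem_setE !in_itv /= andbT; case: ltP => //= t0.
rewrite subrr powRr0 mul1r /pos_pow subr_ge0; case: ifPn => //= t1.
by rewrite powR_mulrn// subr_ge0.
Qed.

End gamma_beta_identity.

(** * The mean of the branching-stable process *)

(** S_t is the mixture, over n and the counting measure, of the spatial projections of Z_n
    restricted to times in [0,t]. *)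
Lemma integral_bsp {R : realType}
    (zeta : seq (nat * nat) -> nat -> option (R * pseq R)) (t : R)
    (g : R -> \bar R) : (forall x, 0 <= g x)%E -> measurable_fun setT g ->
  (\int[bsp zeta t]_x g x = \sum_(0 <= n <oo) \esum_(u in [set: n.-tuple (nat * nat)])
    oapp (fun z => if (0 <= z.1 <= t)%R then g z.2 else 0) 0 (position zeta u))%E.
Proof.
move=> g0 mg.
pose D : set (R * R) := `[0, t]%classic `*` setT.
have mD : measurable D by exact: measurableX.
pose Z n := @point_measure _ _ R _ (fun u : n.-tuple (nat * nat) => position zeta u).
pose proj : {mfun (R * R)%type >-> R} := HB.pack snd
  (isMeasurableFun.Build _ _ _ _ _ (@measurable_snd _ _ R R)).
have mgsnd : measurable_fun setT (g \o snd : R * R -> \bar R).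
  exact: (measurableT_comp mg measurable_snd).
rewrite (@integral_mixture _ _ _ _ _ counting setT _
  (fun n => pushforward (mrestr (Z n) mD) proj))//.
- rewrite ge0_integral_count; last by move=> n; exact: integral_ge0.
  apply: eq_eseriesr => n _.
  rewrite (ge0_integral_pushforward (measurable_funPT proj))//.
  rewrite preimage_setT integral_mrestr//; last by move=> z; exact: g0.
  rewrite integral_mkcond integral_point_measure//.
  + apply: eq_esum => u _; case: position => [[s y]|] //=.
    by rewrite patchE in_setX /= in_setT andbT mem_setE in_itv.
  + by move=> z; rewrite patchE; case: ifPn => // _; exact: g0.
  + by apply/measurable_restrict => //; exact: measurable_funTS.
- move=> A mA; rewrite ge0_integral_count//.
  apply: eq_eseriesr => n _; rewrite /= /pushforward /mrestr /brw.
  congr (point_measure _ _); apply/seteqP.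
  by split => -[s y] /=; rewrite /D /=; tauto.
Qed.

Lemma measurable_strip {R : realType} (t : R) (g : R -> \bar R) :
  measurable_fun setT g ->
  measurable_fun [set: R * R] (fun z => if 0 <= z.1 <= t then g z.2 else 0%E).
Proof.
move=> mg; apply: measurable_fun_ifT => //.
  by apply: measurable_and; apply: measurable_fun_ler => //; exact: measurable_fst.
exact: (measurableT_comp mg measurable_snd).
Qed.

Section mean_bsp.
Context {R : realType} (alpha : R) (lam : {finite_measure set (pseq R) -> \bar R}).
Context d (Omega : measurableType d) (P : probability Omega R).
Variable xi : seq (nat * nat) -> nat -> Omega -> option (R * pseq R).
Hypothesis xi_family : branching_family P alpha lam xi.
Local Open Scope ereal_scope.

Lemma mean_bsp (t : R) (g : R -> \bar R) : (forall x, 0 <= g x) ->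
  measurable_fun setT g ->
  \int[P]_w \int[bsp (fun u i => xi u i w) t]_x g x =
  \sum_(0 <= n <oo) mean_brw xi_family n
    (fun z => if (0 <= z.1 <= t)%R then g z.2 else 0).
Proof.
move=> g0 mg; pose f (z : R * R) := if (0 <= z.1 <= t)%R then g z.2 else 0.
have f0 z : 0 <= f z by rewrite /f; case: ifPn.
have mf : measurable_fun setT f by exact: measurable_strip.
under eq_integral do rewrite integral_bsp//.
rewrite integral_nneseries//.
- apply: eq_eseriesr => n _; rewrite integral_esum//.
  + by apply: eq_esum => u _; rewrite integral_law.
  + by move=> u; exact: (measurable_oapp (measurable_pos xi_family u) f0 mf).
  + by move=> u w; case: position.
- move=> n; apply: measurable_fun_esum => u.
    exact: (measurable_oapp (measurable_pos xi_family u) f0 mf).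
  by move=> w; case: position.
- by move=> n w _; apply: esum_ge0 => u _; case: position.
Qed.

(** Time and space separate: the iterates are the product of [(t-s)_+^m / m!] with [g m]. The
    spatial recursion is left as a hypothesis, so that both claims of the theorem are instances. *)
Lemma mean_brw_product (t : R) (g : nat -> R -> R) n : (0 <= t)%R ->
  (forall m x, 0 <= g m x)%R -> (forall m, measurable_fun setT (g m)) ->
  (forall m x, (0 <= x)%R ->
    c_lambda alpha lam * \int[lebesgue_pos]_y
      ((y `^ (alpha - 1))%:E * (g m (x + y)%R)%:E) = (g m.+1 x)%:E) ->
  mean_brw xi_family n (fun z => if (0 <= z.1 <= t)%R then (g 0%N z.2)%:E else 0) =
  (t ^+ n / n`!%:R * g n 0)%:E.
Proof.
move=> t0 g0 mg gS.
pose F m (z : R * R) := (pos_pow m%:R (t - z.1) / m`!%:R * g m z.2)%:E.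
have F0 m z : 0 <= F m z.
  by rewrite lee_fin !mulr_ge0 ?invr_ge0 ?pos_pow_ge0.
have mF m : measurable_fun setT (F m).
  apply/measurable_EFinP; apply: measurable_funM.
    apply: measurable_funM => //.
    exact: (measurableT_comp (measurable_pos_powB m%:R t) measurable_fst).
  exact: (measurableT_comp (mg m) measurable_snd).
rewrite (@eq_mean_brw _ _ _ _ _ _ _ xi_family n _ (F 0%N))//; last 3 first.
- by move=> z; case: ifPn => // _; rewrite lee_fin.
- by apply: (@measurable_strip _ _ (EFin \o g 0%N)); exact/measurable_EFinP.
- move=> z; rewrite inE => -[z1 z2].
  (* At exponent 0 the truncated power is the indicator of s <= t; the condition 0 <= s holds on the
     quadrant. *)
  rewrite z1 /F /pos_pow subr_ge0 powRr0 divr1 /=.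
  by case: ifPn => _; rewrite ?mul1r ?mul0r.
rewrite (mean_brw_iter xi_family n F0 mF); last first.
  move=> m z; rewrite inE => -[z1 z2]; rewrite /step.
  pose K := (pos_pow m.+1%:R (t - z.1) / m.+1`!%:R)%R.
  have inner y : \int[lebesgue_pos]_s F m (z.1 + s, z.2 + y)%R =
      K%:E * (g m (z.2 + y)%R)%:E.
    rewrite /F /=.
    (* Lebesgue measure has density [s ^ (a - 1)] with a = 1, so the time integral is also a beta
       convolution. *)
    transitivity (\int[lebesgue_pos]_s ((g m (z.2 + y) / m`!%:R)%:E *
      ((s `^ (1 - 1))%:E * (pos_pow m%:R (t - z.1 - s))%:E))).
      apply: eq_integral => s _; rewrite -!EFinM subrr powRr0 opprD addrA.
      by congr (_%:E); ring.
    rewrite ge0_integralZl//; last 3 first.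
    - apply: emeasurable_funM; apply/measurable_EFinP.
        exact: measurable_powR.
      exact: measurable_pos_powB.
    - by move=> s _; rewrite -EFinM lee_fin mulr_ge0 ?powR_ge0 ?pos_pow_ge0.
    - by rewrite lee_fin mulr_ge0 ?invr_ge0.
    rewrite beta_convolution// beta_int1n -!EFinM /K nat1r factS natrM invfM.
    by congr (_%:E); ring.
  under eq_integral do rewrite inner muleCA.
  rewrite ge0_integralZl//; last 3 first.
  - apply: emeasurable_funM; apply/measurable_EFinP.
      exact: measurable_powR.
    by apply: (measurableT_comp (mg m)); exact: measurable_funD.
  - by move=> y _; rewrite -EFinM lee_fin mulr_ge0 ?powR_ge0.
  - by rewrite lee_fin mulr_ge0 ?pos_pow_ge0 ?invr_ge0.
  by rewrite muleCA gS// -EFinM.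
by rewrite /F /= subr0 /pos_pow t0 powR_mulrn.
Qed.

End mean_bsp.

(** * Finiteness of Gamma at the points n alpha + 1 *)

Section gamma_finite.
Context {R : realType} (alpha : R).
Hypothesis alpha_gt0 : 0 < alpha.
Hypothesis Gamma_alpha : Gamma alpha != 0.

(** A divergent integral would make [Gamma alpha] equal to 0, the default value of [fine]. *)
Lemma gamma_int_alpha : gamma_int alpha = (Gamma alpha)%:E.
Proof.
rewrite GammaE fineK// ge0_fin_numE ?gamma_int_ge0// ltey.
by apply: contra Gamma_alpha => /eqP G; rewrite GammaE G.
Qed.

Let alphan_ge0 n : 0 <= alpha * n%:R.
Proof. by rewrite mulr_ge0 ?(ltW alpha_gt0). Qed.

Let alphanS n : alpha + alpha * n%:R = alpha * n.+1%:R.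
Proof. by rewrite -[n.+1]add1n natrD mulrDr mulr1. Qed.

Lemma beta_int_arith n :
  (beta_int alpha (alpha * n%:R) * gamma_int (alpha * n.+1%:R + 1) =
   (Gamma alpha)%:E * gamma_int (alpha * n%:R + 1))%E.
Proof.
have := gamma_beta alpha_gt0 (alphan_ge0 n).
by rewrite alphanS gamma_int_alpha; exact.
Qed.

Let gamma_int_gt0 n : (0 < gamma_int (alpha * n%:R + 1))%E.
Proof.
rewrite (lt_le_trans _ (gamma_int_ge_expN2 _)) ?lte_fin ?expR_gt0//.
by rewrite lerDr.
Qed.

Let Gamma_alpha_gt0 : 0 < Gamma alpha.
Proof.
by rewrite lt_def Gamma_alpha -lee_fin -gamma_int_alpha gamma_int_ge0.
Qed.

(* The beta identity bounds [Gamma (alpha * n.+1 + 1)] by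
   [Gamma (alpha * n + 1)], with no estimate of the integrand. *)
Lemma gamma_int_arith n :
  gamma_int (alpha * n%:R + 1) = (Gamma (alpha * n%:R + 1))%:E.
Proof.
rewrite GammaE fineK//.
elim: n => [|n ih]; first by rewrite mulr0 add0r gamma_int1.
rewrite ge0_fin_numE ?gamma_int_ge0// ltey; apply/eqP => Goo.
have := beta_int_arith n; rewrite Goo => BG.
(* The product of 0 and +oo is 0, so a vanishing beta integral is excluded separately, by positivity
   of the right side; otherwise the left side is infinite and the right side finite. *)
have [B0|B0] := eqVneq (beta_int alpha (alpha * n%:R)) 0%E.
  have : (0 < (Gamma alpha)%:E * gamma_int (alpha * n%:R + 1))%E.
    by rewrite mule_gt0// lte_fin.
  by rewrite -BG B0 mul0e ltxx.
rewrite gt0_muley in BG; last by rewrite lt_def B0 beta_int_ge0.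
have : ((Gamma alpha)%:E * gamma_int (alpha * n%:R + 1))%E \is a fin_num.
  by rewrite fin_numM.
by rewrite -BG.
Qed.

Lemma Gamma_arith_ge n : expR (- 2) <= Gamma (alpha * n%:R + 1).
Proof.
by rewrite -lee_fin -gamma_int_arith gamma_int_ge_expN2// lerDr.
Qed.

Lemma Gamma_arith_gt0 n : 0 < Gamma (alpha * n%:R + 1).
Proof. exact: lt_le_trans (expR_gt0 _) (Gamma_arith_ge n). Qed.

(* The semigroup property of Riemann-Liouville fractional integrals. *)
Lemma fractional_integral n u :
  ((Gamma alpha)^-1%:E * \int[lebesgue_pos]_y ((y `^ (alpha - 1))%:E *
     (pos_pow (alpha * n%:R) (u - y) / Gamma (alpha * n%:R + 1))%:E) =
   (pos_pow (alpha * n.+1%:R) u / Gamma (alpha * n.+1%:R + 1))%:E)%E.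
Proof.
have key (a b c p : R) : a != 0 -> b != 0 -> c != 0 ->
    a^-1 * (b^-1 * ((a * b / c) * p)) = p / c.
  by move=> a0 b0 c0; field; rewrite a0 b0 c0.
have G0 m : Gamma (alpha * m%:R + 1) != 0.
  exact: lt0r_neq0 (Gamma_arith_gt0 m).
have Binv : beta_int alpha (alpha * n%:R) =
    (Gamma alpha * Gamma (alpha * n%:R + 1) / Gamma (alpha * n.+1%:R + 1))%:E.
  have := beta_int_arith n; rewrite !gamma_int_arith -EFinM.
  move: (Gamma_arith_gt0 n.+1) (beta_int_ge0 alpha (alpha * n%:R)).
  move: (beta_int _ _) (Gamma _) (Gamma _ * Gamma _) => [b|//|//] c e c0 _.
    by rewrite -EFinM => -[<-]; rewrite mulfK// gt_eqF.
  by rewrite gt0_mulye// lte_fin.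
under eq_integral do rewrite EFinM muleA muleC.
rewrite ge0_integralZl; last 4 first.
- exact: measurableT.
- apply: emeasurable_funM; apply/measurable_EFinP.
    exact: measurable_powR.
  exact: measurable_pos_powB.
- by move=> y _; rewrite -EFinM lee_fin mulr_ge0 ?powR_ge0 ?pos_pow_ge0.
- by rewrite lee_fin invr_ge0; exact: ltW (Gamma_arith_gt0 n).
rewrite (beta_convolution _ alpha_gt0 (alphan_ge0 n)) Binv alphanS -!EFinM.
congr (_%:E); exact: (key _ _ _ _ Gamma_alpha (G0 n) (G0 n.+1)).
Qed.

End gamma_finite.

(** * The Wright series and the two formulas *)

Lemma is_cvg_Wright_terms {R : realType} (z e : R) (G : nat -> R) :
  0 <= z -> 0 < e -> (forall n, e <= G n) ->
  cvgn (series (fun n => z ^+ n / (n`!%:R * G n))).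
Proof.
move=> z0 e0 eG.
have G0 n : 0 < G n by exact: lt_le_trans (eG n).
(* The uniform lower bound [e] of the denominators allows domination by a multiple of the
   exponential series. *)
apply: (@series_le_cvg _ _ (e^-1 *: exp_coeff z)).
- by move=> n; rewrite divr_ge0 ?exprn_ge0// mulr_ge0// ltW.
- by move=> n; rewrite mulr_ge0 ?invr_ge0 ?(ltW e0)// exp_coeff_ge0.
- move=> n; rewrite [leRHS]mulrC /exp_coeff /= invfM mulrA.
  rewrite ler_wpM2l ?divr_ge0 ?exprn_ge0// lef_pV2 ?posrE//.
- by apply: is_cvg_seriesZ; exact: is_cvg_series_exp_coeff.
Qed.

Theorem proposition3p2 (R : realType) (alpha : R)
    (lam : {finite_measure set (pseq R) -> \bar R})
    (d : measure_display) (Omega : measurableType d) (P : probability Omega R)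
    (xi : seq (nat * nat) -> nat -> Omega -> option (R * pseq R))
    (alpha_gt0 : 0 < alpha)
    (lam_neq0 : lam [set: pseq R] != 0%E)
    (c_fin : (c_lambda alpha lam < +oo)%E)
    (c_norm : (c_lambda alpha lam * (Gamma alpha)%:E = 1)%E)
    (xi_family : branching_family P alpha lam xi) :
  let S (t : R) (w : Omega) := bsp (fun u i => xi u i w) t in
  (forall x t : R, 0 < x -> 0 < t ->
    (\int[P]_w S t w `[0%R, x]%classic = (Wright alpha 1 (t * x `^ alpha))%:E)%E) /\
  (forall theta t : R, 0 < theta -> 0 < t ->
    (\int[P]_w \int[S t w]_(x in `[0%R, +oo[) (expR (- (theta * x)))%:E
     = (expR (t * theta `^ (- alpha)))%:E)%E).
Proof.
move=> S.
(* The normalization thus forces Euler's integral at [alpha] to converge. *)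
have G0 : Gamma alpha != 0.
  apply/eqP => G0; move: c_norm; rewrite G0 mule0 => /eqP.
  by rewrite eqe eq_sym oner_eq0.
have cE : c_lambda alpha lam = (Gamma alpha)^-1%:E.
  move: c_norm c_fin (c_lambda_ge0 alpha lam).
  case: (c_lambda alpha lam) => [c|//|//]; rewrite -EFinM => -[cG] _ _.
  by congr (_%:E); rewrite -[RHS]mul1r -cG mulfK.
split=> [x t x0 t0|theta t th0 t0].
- have [G [GE G1 Gge GS]] : exists G : nat -> R,
      [/\ forall n, Gamma (alpha * n%:R + 1) = G n, G 0%N = 1,
          forall n, expR (- 2) <= G n &
          forall n u, (c_lambda alpha lam * \int[lebesgue_pos]_y
              ((y `^ (alpha - 1))%:E * (pos_pow (alpha * n%:R) (u - y) / G n)%:E) =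
            (pos_pow (alpha * n.+1%:R) u / G n.+1)%:E)%E].
    exists (fun n => Gamma (alpha * n%:R + 1)); split => //.
    + by rewrite mulr0 add0r GammaE gamma_int1.
    + exact: Gamma_arith_ge.
    + by rewrite cE; exact: fractional_integral.
  have G_gt0 n : 0 < G n by exact: lt_le_trans (expR_gt0 _) (Gge n).
  pose g n (y : R) := pos_pow (alpha * n%:R) (x - y) / G n.
  have g0 n y : 0 <= g n y by rewrite divr_ge0 ?pos_pow_ge0// ltW.
  have mg n : measurable_fun setT (g n).
    by apply: measurable_funM => //; exact: measurable_pos_powB.
  have mindic : measurable_fun [set: R] (fun y => (\1_(`[0, x]%classic) y : R)%:E).
    by apply/measurable_EFinP; exact: measurable_indic.
  transitivity (\int[P]_w \int[S t w]_y (\1_(`[0, x]%classic) y : R)%:E)%E.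
    by apply: eq_integral => w _; rewrite integral_indic// setIT.
  rewrite (mean_bsp xi_family)//.
  transitivity (\sum_(0 <= n <oo)
      ((t * x `^ alpha) ^+ n / (n`!%:R * G n))%:E)%E.
    apply: eq_eseriesr => n _.
    transitivity ((t ^+ n / n`!%:R * g n 0)%:E).
      rewrite -(mean_brw_product xi_family n (ltW t0) g0 mg); last first.
        move=> m y y0; rewrite /g -GS.
        by congr (_ * _)%E; apply: eq_integral => v _; rewrite opprD addrA.
      apply: eq_mean_brw.
      + by move=> z; case: ifPn => // _; rewrite lee_fin.
      + exact: measurable_strip mindic.
      + by move=> z; case: ifPn => // _; rewrite lee_fin.
      + by apply: (@measurable_strip _ _ (EFin \o g 0%N)); exact/measurable_EFinP.
      (* [g 0] is the indicator of y <= x, which agrees with that of [0,x] only for y >= 0. *)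
      + move=> z; rewrite inE => -[_ z2]; case: ifPn => // _; congr (_%:E).
        rewrite /g mulr0 G1 divr1 indicE mem_setE in_itv /=.
        by rewrite z2 /pos_pow subr_ge0 powRr0; case: ifPn.
    congr (_%:E); rewrite /g subr0 /pos_pow (ltW x0) powRrM.
    rewrite powR_mulrn ?powR_ge0// exprMn invfM.
    by ring.
  rewrite eseries_EFin; last first.
    by apply: is_cvg_Wright_terms (expR_gt0 (- 2)) Gge; rewrite mulr_ge0 ?powR_ge0// ltW.
  by rewrite /Wright; under eq_fun do rewrite -GE.
(* The exponential is an eigenfunction of the spatial part of [step], with eigenvalue
   [theta ^ (- alpha)]. *)
- pose g n (y : R) := (theta `^ (- alpha)) ^+ n * expR (- (theta * y)).
  have g0 n y : 0 <= g n y by rewrite mulr_ge0 ?expR_ge0// exprn_ge0// powR_ge0.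
  have mexp : measurable_fun setT (fun y : R => expR (- (theta * y))).
    apply: (measurableT_comp (@measurable_expR R)); apply: measurable_funN.
    exact: measurable_funM.
  have mg n : measurable_fun setT (g n) by exact: measurable_funM.
  (* Extension by 0 turns the integral over [0,oo) into one over the line; on the quadrant [h] is
     the exponential itself. *)
  pose h := (fun y : R => (expR (- (theta * y)))%:E) \_ `[0, +oo[%classic.
  have h0 y : (0 <= h y)%E.
    by rewrite /h patchE; case: ifPn => // _; rewrite lee_fin expR_ge0.
  have mh : measurable_fun setT h.
    apply/measurable_restrict => //; apply: measurable_funTS.
    exact/measurable_EFinP.
  transitivity (\int[P]_w \int[S t w]_y h y)%E.
    by apply: eq_integral => w _; rewrite integral_mkcond.
  rewrite (mean_bsp xi_family)// -eseries_exp; apply: eq_eseriesr => n _.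
  transitivity ((t ^+ n / n`!%:R * g n 0)%:E).
    rewrite -(mean_brw_product xi_family n (ltW t0) g0 mg); last first.
      move=> m y y0; rewrite cE /g.
      under eq_integral do rewrite EFinM muleCA.
      rewrite ge0_integralZl//; last 3 first.
      + apply: emeasurable_funM; apply/measurable_EFinP.
          exact: measurable_powR.
        by apply: (measurableT_comp mexp); exact: measurable_funD.
      + by move=> v _; rewrite -EFinM lee_fin mulr_ge0 ?powR_ge0 ?expR_ge0.
      + by rewrite lee_fin exprn_ge0// powR_ge0.
      rewrite laplace_density// (gamma_int_alpha G0) -!EFinM.
      by congr (_%:E); rewrite exprS; field.
    apply: eq_mean_brw.
    + by move=> z; case: ifPn.
    + exact: measurable_strip.
    + by move=> z; case: ifPn => // _; rewrite lee_fin.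
    + by apply: (@measurable_strip _ _ (EFin \o g 0%N)); exact/measurable_EFinP.
    + move=> z; rewrite inE => -[_ z2]; case: ifPn => // _.
      by rewrite /h patchE mem_setE in_itv /= andbT z2 /g expr0 mul1r.
  congr (_%:E); rewrite /g mulr0 oppr0 expR0 mulr1 exprMn.
  by ring.
Qed.
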